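(* Let $d\ge 5$. On a very general surface of degree $d$ in $\mathbb P^3$ there is no rational curve.
   Context: The ground field is $\mathbb C$. A rational curve is a reduced irreducible curve of geometric genus $0$. ''Very general'' means outside a countable union of proper Zariski closed subsets of $|\mathcal O_{\mathbb P^3}(d)|$. *)

(* Defs.v *)
From HB Require Import structures.
From mathcomp Require Import all_boot all_algebra.
From mathcomp Require Import ring_quotient fraction.
From mathcomp Require Import boolp reals complex.
From mathcomp.multinomials Require Import mpoly.

Set Implicit Arguments.
Unset Strict Implicit.
Unset Printing Implicit Defensive.

Import GRing.Theory.
Local Open Scope ring_scope.

(* An integral closed subscheme of P^(n-1) over k is given by its homogeneous
   prime ideal P in k[x_0, ..., x_(n-1)].  Ideals are bool-valued predicates;
   with the classical axioms of boolp this is no restriction.               *)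

Section CoordinateRing.
Variables (R : comNzRingType) (P : prime_idealr R).

Definition coord_ring : Type := {ideal_quot P}.

HB.instance Definition _ := GRing.ComNzRing.on coord_ring.

Definition coord_class (f : R) : coord_ring := \pi_{ideal_quot P}%qT f.

Lemma coord_class_is_zmod_morphism : zmod_morphism coord_class.
Proof. exact: (raddfB (\pi_{ideal_quot P}%qT)). Qed.

Lemma coord_class_is_monoid_morphism : monoid_morphism coord_class.
Proof.
split; first exact: (rmorph1 (\pi_{ideal_quot P}%qT)).
exact: (rmorphM (\pi_{ideal_quot P}%qT)).
Qed.

HB.instance Definition _ := GRing.isZmodMorphism.Build R coord_ring coord_class
  coord_class_is_zmod_morphism.
HB.instance Definition _ := GRing.isMonoidMorphism.Build R coord_ring
  coord_class coord_class_is_monoid_morphism.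

Lemma coord_class_eq0 f : (coord_class f == 0) = (f \in P).
Proof.
rewrite -(rmorph0 coord_class) /coord_class.
by rewrite -Quotient.idealrBE subr0.
Qed.

Definition coord_unit : {pred coord_ring} :=
  fun x => `[< exists y, y * x = 1 >].

Definition coord_inv (x : coord_ring) : coord_ring :=
  if pselect (exists y, y * x = 1) is left e then projT1 (cid e) else x.

Lemma coord_mulVx : {in coord_unit, left_inverse 1 coord_inv *%R}.
Proof.
move=> x /asboolP ux; rewrite /coord_inv.
by case: pselect => // e; case: (cid e).
Qed.

Lemma coord_unitPl x y : y * x = 1 -> coord_unit x.
Proof. by move=> yx; apply/asboolP; exists y. Qed.

Lemma coord_inv_out : {in [predC coord_unit], coord_inv =1 id}.
Proof.
move=> x /negP ux; rewrite /coord_inv.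
by case: pselect => // e; case: ux; apply/asboolP.
Qed.

HB.instance Definition _ := GRing.ComNzRing_hasMulInverse.Build coord_ring
  coord_mulVx coord_unitPl coord_inv_out.

Lemma coord_integral (x y : coord_ring) : x * y = 0 -> (x == 0) || (y == 0).
Proof. exact: Quotient.rquot_IdomainAxiom. Qed.

HB.instance Definition _ := GRing.ComUnitRing_isIntegral.Build coord_ring
  coord_integral.

End CoordinateRing.

Section SubField.
Variables (F : fieldType) (S : divringClosed F).

Record subfield_of := SubField {
  subfield_val :> F;
  _ : subfield_val \in S
}.

HB.instance Definition _ := [isSub for subfield_val].
HB.instance Definition _ := [Choice of subfield_of by <:].
HB.instance Definition _ :=
  [SubChoice_isSubIntegralDomain of subfield_of by <:].
HB.instance Definition _ :=
  [SubIntegralDomain_isSubField of subfield_of by <:].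

End SubField.

Section FunctionField.
Variables (k : fieldType) (n : nat) (P : prime_idealr {mpoly k[n]}).

Definition homog_frac (f g : {mpoly k[n]}) : {fraction coord_ring P} :=
  tofrac (coord_class P f) / tofrac (coord_class P g).

Definition rational_function : {pred {fraction coord_ring P}} :=
  fun x => `[< exists (e : nat) (f g : {mpoly k[n]}),
    [/\ f \is e.-homog, g \is e.-homog, g \notin P & x = homog_frac f g] >].

Let tofrac_class_neq0 (g : {mpoly k[n]}) :
  g \notin P -> tofrac (coord_class P g) != 0.
Proof. by rewrite tofrac_eq0 coord_class_eq0. Qed.

Lemma rational_function_divring_closed : divring_closed rational_function.
Proof.
have P1 : (1 : {mpoly k[n]}) \notin P by rewrite idealr1.
split.
- apply/asboolP; exists 0%N, 1, 1; split; rewrite ?dhomog1 //.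
  by rewrite /homog_frac !rmorph1 divr1.
- move=> x y /asboolP[e [f [g [hf hg Pg ->]]]] /asboolP[e' [f' [g' [hf' hg' Pg' ->]]]].
  apply/asboolP; exists (e + e')%N, (f * g' - f' * g), (g * g'); split.
  + by apply: rpredB; [|rewrite addnC]; apply: dhomogM.
  + exact: dhomogM.
  + by rewrite prime_idealrM negb_or Pg.
  rewrite /homog_frac -mulNr addf_div ?tofrac_class_neq0 //.
  by rewrite !(rmorphB, rmorphM) /= mulNr.
- move=> x y /asboolP[e [f [g [hf hg Pg ->]]]] /asboolP[e' [f' [g' [hf' hg' Pg' ->]]]].
  apply/asboolP; case: (boolP (f' \in P)) => Pf'.
    exists 0%N, 0, 1; split; rewrite ?dhomog1 ?rpred0 //.
    move: (Pf'); rewrite -coord_class_eq0 => /eqP f'0.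
    by rewrite /homog_frac f'0 !rmorph0 mul0r invr0 mulr0 mul0r.
  exists (e + e')%N, (f * g'), (g * f'); split.
  + exact: dhomogM.
  + exact: dhomogM.
  + by rewrite prime_idealrM negb_or Pg.
  by rewrite /homog_frac invf_div mulf_div !rmorphM.
Qed.

HB.instance Definition _ := GRing.isDivringClosed.Build _ rational_function
  rational_function_divring_closed.

Definition function_field : Type := subfield_of rational_function.

HB.instance Definition _ := GRing.Field.on function_field.

Lemma constant_subproof (c : k) :
  tofrac (coord_class P c%:MP) \in rational_function.
Proof.
apply/asboolP; exists 0%N, c%:MP, 1; split; rewrite ?dhomog1 //.
- by rewrite -[c]mulr1 mpolyCM mul_mpolyC dhomogZ ?dhomog1.
- by rewrite idealr1.
- by rewrite /homog_frac rmorph1 rmorph1 divr1.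
Qed.

Definition constant (c : k) : function_field :=
  @SubField _ rational_function _ (constant_subproof c).

Lemma constant_is_zmod_morphism : zmod_morphism constant.
Proof. by move=> a b; apply: val_inj; rewrite /= !rmorphB. Qed.

Lemma constant_is_monoid_morphism : monoid_morphism constant.
Proof.
split; first by apply: val_inj; rewrite /= !rmorph1.
by move=> a b; apply: val_inj; rewrite /= !rmorphM.
Qed.

HB.instance Definition _ := GRing.isZmodMorphism.Build k function_field
  constant constant_is_zmod_morphism.
HB.instance Definition _ := GRing.isMonoidMorphism.Build k function_field
  constant constant_is_monoid_morphism.

End FunctionField.

Section FieldExtension.
Variables (k K : fieldType) (iota : {rmorphism k -> K}).

Definition alg_independent (m : nat) (a : 'I_m -> K) : Prop :=
  forall p : {mpoly k[m]}, mmap iota a p = 0 -> p = 0.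

Definition has_trdeg (m : nat) : Prop :=
  (exists a : 'I_m -> K, alg_independent a) /\
  forall a : 'I_m.+1 -> K, ~ alg_independent a.

(* When K is a function field in one variable, the proper valuation rings of
   K containing k are the local rings at the closed points of the smooth
   projective curve with function field K.                                  *)
Definition valuation_ring (O : {pred K}) : Prop :=
  [/\ subring_closed O,
      forall c, iota c \in O,
      exists x, x \notin O &
      forall x, x \notin O -> x^-1 \in O].

Definition derivation (D : K -> K) : Prop :=
  [/\ {morph D : x y / x + y},
      forall x y, D (x * y) = x * D y + y * D x &
      forall c, D (iota c) = 0].

(* A Kaehler differential \sum_j f_j dg_j is presented by the list of the
   pairs (f_j, g_j).  The K-linear forms on Omega_{K/k} are the derivations
   of K over k, and they separate the elements of this K-vector space, so two
   presentations define the same differential iff all derivations take the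
   same value on them.                                                      *)
Definition differential : Type := seq (K * K).

Definition contract (w : differential) (D : K -> K) : K :=
  \sum_(fg <- w) fg.1 * D fg.2.

Definition same_differential (w w' : differential) : Prop :=
  forall D, derivation D -> contract w D = contract w' D.

(* w is in the image of Omega_{O/k} in Omega_{K/k}. *)
Definition regular_at (O : {pred K}) (w : differential) : Prop :=
  exists2 w', same_differential w w' &
    {in w', forall fg, fg.1 \in O /\ fg.2 \in O}.

Definition regular_differential (w : differential) : Prop :=
  forall O, valuation_ring O -> regular_at O w.

Definition lin_comb (g : nat) (c : 'I_g -> k) (b : 'I_g -> differential) :
    differential :=
  flatten [seq [seq (iota (c i) * fg.1, fg.2) | fg <- b i] | i <- enum 'I_g].

(* The space of everywhere regular differentials has a k-basis of size g. *)
Definition has_genus (g : nat) : Prop :=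
  exists b : 'I_g -> differential,
    (forall i, regular_differential (b i)) /\
    forall w, regular_differential w ->
      exists! c : {ffun 'I_g -> k}, same_differential w (lin_comb c b).

End FieldExtension.

Section Curves.
Variables (k : fieldType) (n : nat).

Definition homogeneous_ideal (P : prime_idealr {mpoly k[n]}) : Prop :=
  forall (f : {mpoly k[n]}) (e : nat), f \in P -> pihomog mdeg e f \in P.

(* The irrelevant ideal, which defines no subscheme, is excluded because its
   [function_field] is k. *)
Definition curve (P : prime_idealr {mpoly k[n]}) : Prop :=
  homogeneous_ideal P /\ has_trdeg (constant P) 1.

(* The geometric genus is the genus of the normalization, the smooth
   projective curve with the same function field. *)
Definition has_geometric_genus (P : prime_idealr {mpoly k[n]}) (g : nat) :
    Prop :=
  has_genus (constant P) g.

Definition rational_curve (P : prime_idealr {mpoly k[n]}) : Prop :=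
  curve P /\ has_geometric_genus P 0.

Definition lies_on (P : prime_idealr {mpoly k[n]}) (F : {mpoly k[n]}) : Prop :=
  F \in P.

End Curves.

Section LinearSystem.
Variables (k : fieldType) (n d : nat).

(* Points of |O_{P^(n-1)}(d)| are represented by nonzero forms; the conditions
   imposed on them below are invariant under scaling. *)
Definition linear_system (F : {mpoly k[n]}) : Prop :=
  F \is d.-homog /\ F != 0.

Definition monomials : {set 'X_{1..n < d.+1}} :=
  [set m : 'X_{1..n < d.+1} | mdeg m == d].

Definition coefs (F : {mpoly k[n]}) : 'I_#|monomials| -> k :=
  fun j => F@_(bmnm (enum_val j)).

Definition zariski_closed (Z : {mpoly k[n]} -> Prop) : Prop :=
  exists S : {mpoly k[#|monomials|]} -> Prop,
    (forall phi, S phi -> exists e : nat, phi \is e.-homog) /\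
    forall F, linear_system F -> (Z F <-> forall phi, S phi -> phi.@[coefs F] = 0).

Definition proper_subset (Z : {mpoly k[n]} -> Prop) : Prop :=
  exists2 F, linear_system F & ~ Z F.

Definition very_general (Q : {mpoly k[n]} -> Prop) : Prop :=
  exists Z : nat -> {mpoly k[n]} -> Prop,
    (forall j, zariski_closed (Z j) /\ proper_subset (Z j)) /\
    forall F, linear_system F -> (forall j, ~ Z j F) -> Q F.

End LinearSystem.

(* Main.v *)
(* A very general form F has coefficients a_m that kill no nonzero homogeneous
   polynomial over Z, so (after rescaling) there are derivations d_m of C, one
   for each monomial of degree d, with d_m a_m' = [m = m'] modulo a_m'.  They
   replace the deformations of F: extended to the function field K = C(X) of a
   curve on the surface, d_m F(X) = 0 reads X^m + grad F(X) . D_m X = 0.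

   Following Ein and Voisin, contract the volume form of the universal surface
   with twisted vector fields.  For u = sum_m q_m(X) D_m X + p(X), with q_m of
   degree d - 4, p_j of degree d - 3 and sum_m q_m x^m = sum_j p_j F_j, the
   differential det(D_o X, X, u, dX), where D_o belongs to the monomial x_o^d,
   is regular at every place O of K: D_m can be replaced by an extension
   preserving O, namely the one that kills a uniformizer, since two extensions
   differ by a derivation over C and these form a space of dimension 1.

   If the genus is 0, all these differentials vanish.  Since d >= 5, the fields
   x_a d_(x_b mu) - x_b d_(x_a mu) and those of gl_4 are available; they
   force det(D_o X, X, e_j, dX) = 0 for every j, so that D_o X lies in the span
   of X and dX, which is orthogonal to grad F(X), whereas
   grad F(X) . D_o X = -1. *)

From HB Require Import structures.
Require Import Defs.
From mathcomp Require Import all_boot all_algebra.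
From mathcomp Require Import ring_quotient fraction reals complex.
From mathcomp Require Import boolp classical_sets.
From mathcomp Require Import ring zify.
From mathcomp.multinomials Require Import mpoly.

Set Implicit Arguments.
Unset Strict Implicit.
Unset Printing Implicit Defensive.

Import GRing.Theory.
Local Open Scope ring_scope.

(** * Extension of derivations *)

(** Absolute derivations: unlike in [derivation], no ground field is required to be killed, so
    nonzero derivations of the constants can be lifted to K. *)
Definition leibniz (A : nzRingType) (D : A -> A) : Prop :=
  {morph D : x y / x + y} /\ forall x y, D (x * y) = x * D y + y * D x.

Section Leibniz.
Variables (A : nzRingType) (D : A -> A).
Hypothesis leibD : leibniz D.

Lemma leibnizD : {morph D : x y / x + y}. Proof. by case: leibD. Qed.

Lemma leibnizM x y : D (x * y) = x * D y + y * D x. Proof. by case: leibD. Qed.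

Lemma leibniz0 : D 0 = 0.
Proof. by apply: (addrI (D 0)); rewrite -leibnizD !addr0. Qed.

Lemma leibnizN : {morph D : x / - x}.
Proof. by move=> x; apply: (addrI (D x)); rewrite -leibnizD !subrr leibniz0. Qed.

Lemma leibnizB : {morph D : x y / x - y}.
Proof. by move=> x y; rewrite leibnizD leibnizN. Qed.

Lemma leibniz1 : D 1 = 0.
Proof.
apply: (addrI (D 1)); rewrite addr0.
by rewrite -{3}[1]mulr1 leibnizM !mul1r.
Qed.

Lemma leibniz_sum I (r : seq I) (P : pred I) (f : I -> A) :
  D (\sum_(i <- r | P i) f i) = \sum_(i <- r | P i) D (f i).
Proof. exact: (big_morph _ leibnizD leibniz0). Qed.

End Leibniz.

Lemma deriv_eq0_size (R : idomainType) (p : {poly R}) :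
  [pchar R] =i pred0 -> p^`() = 0 -> (size p <= 1)%N.
Proof.
move=> charR dp0; rewrite leqNgt; apply/negP => lt1.
have sz : ((size p).-2.+1 = (size p).-1)%N by case: (size p) lt1 => [|[]].
have := congr1 (fun q : {poly R} => q`_(size p).-2) dp0.
rewrite coef_deriv coef0 sz -/(lead_coef p) -mulr_natr => /eqP.
rewrite mulf_eq0 lead_coef_eq0 ((pcharf0P R).1 charR) -size_poly_eq0.
by case: (size p) lt1 => [|[]].
Qed.

Section DerivationExtension.
Variable K : fieldType.
Hypothesis charK : [pchar K] =i pred0.

(* The graph of a derivation from a subring of K to K: a subring of the dual
   numbers K[e], the pair (x, a) standing for x + a e, that meets K e in 0. *)
Definition partial_derivation (G : K -> K -> Prop) : Prop :=
  [/\ forall a, G 0 a -> a = 0, G 1 0,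
      forall x a y b, G x a -> G y b -> G (x - y) (a - b) &
      forall x a y b, G x a -> G y b -> G (x * y) (x * b + y * a)].

Section Partial.
Variable G : K -> K -> Prop.
Hypothesis pdG : partial_derivation G.

Let G0 a : G 0 a -> a = 0. Proof. by case: pdG => h _ _ _; apply: h. Qed.
Let G1 : G 1 0. Proof. by case: pdG. Qed.
Let GB x a y b : G x a -> G y b -> G (x - y) (a - b).
Proof. by case: pdG => _ _ h _; apply: h. Qed.
Let GM x a y b : G x a -> G y b -> G (x * y) (x * b + y * a).
Proof. by case: pdG => _ _ _; apply. Qed.
Let G00 : G 0 0. Proof. by have := GB G1 G1; rewrite !subrr. Qed.
Lemma partial_derivationD x a y b : G x a -> G y b -> G (x + y) (a + b).
Proof.
move=> gx gy; have := GB gx (GB G00 gy).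
by rewrite !sub0r !opprK.
Qed.

(** The polynomial [p + q e] has all its coefficients in the subring [G] of the dual numbers. *)
Let lift (p q : {poly K}) := forall i, G p`_i q`_i.

Let liftC x a : G x a -> lift x%:P a%:P.
Proof. by move=> gx i; rewrite !coefC; case: (i == 0). Qed.

Let liftX : lift 'X 0.
Proof. by move=> i; rewrite coefX coef0; case: (i == 1)%N. Qed.

Let liftB p q p' q' : lift p q -> lift p' q' -> lift (p - p') (q - q').
Proof. by move=> l l' i; rewrite !coefB; apply: GB. Qed.

Let liftM p q p' q' : lift p q -> lift p' q' -> lift (p * p') (p * q' + p' * q).
Proof.
move=> l l' i; rewrite [p' * q]mulrC coefD !coefM -big_split /=.
elim/big_rec2: _ => // j a y _ gy; apply: partial_derivationD => //.
by rewrite [q`__ * _]mulrC; apply: GM.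
Qed.

Let liftd p q : lift p q -> lift p^`() q^`().
Proof.
move=> l i; rewrite !coef_deriv; have := l i.+1.
move: (p`_i.+1) (q`_i.+1) => y b gy; elim: (i.+1) => [|n IH]; first by rewrite !mulr0n; apply: G00.
by rewrite !mulrS; apply: partial_derivationD.
Qed.

Let lift0 q : lift 0 q -> q = 0.
Proof.
by move=> l; apply/polyP => i; rewrite coef0; apply: G0; have := l i; rewrite coef0.
Qed.

Variable x : K.

(** The [e]-part of the value of [p + q e] at [x + v e]. *)
Let N v (p q : {poly K}) := q.[x] + p^`().[x] * v.

(** A value v at x must respect every relation p(x) = 0. Without nonzero relations any v does;
    otherwise a relation p0 of least size determines v, and pseudo-division by p0 gives the other
    relations by induction on the size. *)
Let adjoin_value : exists v, forall p q, lift p q -> p.[x] = 0 -> N v p q = 0.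
Proof.
have [[p1 [q1 [l1 p1n0 p1x]]]|trx] :=
  pselect (exists p q, [/\ lift p q, p != 0 & p.[x] = 0]); last first.
  exists 0 => p q l px; have [p0|pn0] := eqVneq p 0; last by case: trx; exists p, q.
  by rewrite /N p0 deriv0 (lift0 (q := q)) ?horner0 ?mul0r ?addr0 // -p0.
pose P n := `[< exists p q, [/\ lift p q, p != 0, p.[x] = 0 & size p = n] >].
have exP : exists n, P n by exists (size p1); apply/asboolP; exists p1, q1.
case: (ex_minnP exP) => n /asboolP[p0 [q0 [l0 p0n0 p0x szp0]]] minP.
have small p q : lift p q -> p.[x] = 0 -> (size p < n)%N -> p = 0.
  move=> l px lt_pn; apply: contraTeq lt_pn => pn0; rewrite -leqNgt; apply: minP.
  by apply/asboolP; exists p, q.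
(* Otherwise p0' would be a smaller relation, hence 0, and p0 a nonzero constant with a root. *)
have dp0x : p0^`().[x] != 0.
  apply/eqP => dp0x; have dp0 : p0^`() = 0.
    by apply: (small _ _ (liftd l0)) => //; rewrite -szp0; apply: lt_size_deriv.
  have sz1 := deriv_eq0_size charK dp0.
  by move: p0n0 p0x; rewrite (size1_polyC sz1) hornerC polyC_eq0 => /eqP.
exists (- q0.[x] / p0^`().[x]); set v := - _ / _.
have N0 : N v p0 q0 = 0 by rewrite /N /v mulrC divfK // addrN.
move=> p q; have [m] := ubnP (size p); elim: m p q => // m IH p q lepm l px.
have [lt_pn|le_np] := ltnP (size p) n.
  have p0E := small _ _ l px lt_pn.
  by rewrite /N p0E deriv0 (lift0 (q := q)) ?horner0 ?mul0r ?addr0 // -p0E.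
have pn0 : p != 0.
  by apply: contraTneq le_np => ->; rewrite size_poly0 -ltnNge -szp0 lt0n size_poly_eq0.
have Xk j : lift 'X^j 0.
  elim: j => [|j IHj]; first by rewrite expr0; apply: liftC.
  by rewrite exprS; have := liftM liftX IHj; rewrite !mulr0 addr0.
(* Pseudo-division: a p - b X^j p0 loses the leading term of p without inverting a, since the domain
   of [G] is only a ring. The [e]-parts a' and b' go along. *)
pose j := (size p - size p0)%N.
pose a := lead_coef p0; pose a' := q0`_(size p0).-1.
pose b := lead_coef p; pose b' := q`_(size p).-1.
have la : lift a%:P a'%:P := liftC (l0 _).
have lb : lift b%:P b'%:P := liftC (l _).
have lr := liftB (liftM la l) (liftM (liftM lb (Xk j)) l0).
set r := _ - _ in lr; set s := _ - _ in lr.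
have rx : r.[x] = 0 by rewrite /r hornerD hornerN !hornerM p0x px !mulr0 subr0.
have szr : (size r < size p)%N.
  have lepp : (size p > 0)%N by rewrite lt0n size_poly_eq0.
  rewrite -(ltn_predK lepp) ltnS; apply/leq_sizeP => i; rewrite leq_eqVlt /r coefB.
  have sz0 : (size p0 > 0)%N by rewrite lt0n size_poly_eq0.
  have sj : ((size p).-1 - j = (size p0).-1)%N.
    by move: le_np lepp; rewrite /j -szp0; lia.
  rewrite mulrAC coefMXn !coefCM => /predU1P[<-|lti].
    rewrite sj ifF; last by apply/negbTE; rewrite -leqNgt /j leq_subLR; move: sz0; lia.
    by rewrite -/(lead_coef p) -/(lead_coef p0) mulrC subrr.
  rewrite (nth_default _ (s := p)); last by rewrite -(ltn_predK lepp).
  rewrite mulr0 sub0r; case: ifP => _; rewrite ?oppr0 //.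
  rewrite (nth_default _ (s := p0)) ?mulr0 ?oppr0 //.
  by move: le_np lepp lti sz0; rewrite /j -szp0; lia.
have := IH r s (leq_trans szr lepm) lr rx.
rewrite /N /r /s !(derivM, derivD, derivN, derivC).
rewrite !(hornerD, hornerN, hornerM, hornerC, horner0) px p0x.
rewrite !(mul0r, mulr0, addr0, add0r) => E.
have an0 : a != 0 by rewrite lead_coef_eq0.
apply: (mulfI an0); rewrite mulr0 -E.
move: N0; rewrite /N => N0.
transitivity (a * (q.[x] + p^`().[x] * v)
  - b * 'X^j.[x] * (q0.[x] + p0^`().[x] * v)); last by ring.
by rewrite N0 mulr0 subr0.
Qed.

(** The new graph consists of the values of the lifted polynomials at [x + v e]; by the choice of v
    it meets K e in 0. *)
Lemma partial_derivation_adjoin : exists G' : K -> K -> Prop, [/\ partial_derivation G',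
  forall y b, G y b -> G' y b & exists v, G' x v].
Proof.
have [v Nv] := adjoin_value.
exists (fun y b => exists p q, [/\ lift p q, y = p.[x] & b = N v p q]); split.
- split=> [a [p [q [l /esym px ->]]]||y a z b|y a z b]; first exact: Nv.
  + exists 1%:P, 0%:P; split; [exact: liftC | by rewrite hornerC |].
    by rewrite /N derivC !hornerC mul0r addr0.
  + move=> [p [q [l -> ->]]] [p' [q' [l' -> ->]]].
    exists (p - p'), (q - q'); split; first exact: liftB.
      by rewrite hornerD hornerN.
    by rewrite /N derivB !hornerD !hornerN; ring.
  + move=> [p [q [l -> ->]]] [p' [q' [l' -> ->]]].
    exists (p * p'), (p * q' + p' * q); split; first exact: liftM.
      by rewrite hornerM.
    by rewrite /N derivM !hornerD !hornerM; ring.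
- move=> y b gy; exists y%:P, b%:P; split; first exact: liftC.
    by rewrite hornerC.
  by rewrite /N derivC !hornerC mul0r addr0.
- exists v, 'X, 0; split; [exact: liftX | by rewrite hornerX |].
  by rewrite /N derivX horner0 hornerC mul1r add0r.
Qed.

End Partial.

(** Zorn's lemma on the graphs containing [G]; the domain of a maximal one is all of K, as any x can
    be adjoined. *)
Lemma derivation_extension (G : K -> K -> Prop) : partial_derivation G ->
  exists2 D : K -> K, leibniz D & forall x a, G x a -> D x = a.
Proof.
(* The union with [G] gives the empty chain an upper bound as well. *)
move=> pdG; pose gr (A : set (K * K)) x a := A (x, a) \/ G x a.
have [|A [pdA maxA]] := @Zorn_bigcup (K * K)%type (fun A => partial_derivation (gr A)).
  move=> F FP Ftot; pose U := (\bigcup_(X in F) X)%classic.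
  have grU x a : gr U x a -> (exists2 A, F A & gr A x a) \/ G x a.
    by case=> [[A FA Axa]|]; [left; exists A => //; left | right].
  have Ugr A x a : F A -> gr A x a -> gr U x a.
    by move=> FA [Axa|]; [left; exists A | right].
  have U2 x a y b : gr U x a -> gr U y b ->
      exists A, [/\ partial_derivation (gr A), gr A x a, gr A y b &
        forall z c, gr A z c -> gr U z c].
    move=> /grU [[A FA ga]|ga] /grU [[B FB gb]|gb].
    - have [AB|BA] := Ftot A B FA FB.
        exists B; split=> //; [exact: FP | | by move=> *; apply: Ugr FB _].
        by case: ga => [/AB|]; [left|right].
      exists A; split=> //; [exact: FP | | by move=> *; apply: Ugr FA _].
      by case: gb => [/BA|]; [left|right].
    - by exists A; split=> //; [exact: FP | right | move=> *; apply: Ugr FA _].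
    - by exists B; split=> //; [exact: FP | right | move=> *; apply: Ugr FB _].
    - exists set0; split; [|by right|by right|by move=> z c []// gz; right].
      suff -> : gr set0 = G by [].
      by apply/funext => z; apply/funext => c; apply/propext; split=> [[]//|]; right.
  case: (pdG) => G0 G1 GB GM; split.
  - by move=> a ga; have [A [[pA _ _ _] gA _ _]] := U2 _ _ _ _ ga ga; apply: pA.
  - by right.
  - move=> x a y b gx gy; have [A [[_ _ pA _] gAx gAy AU]] := U2 _ _ _ _ gx gy.
    by apply: AU; apply: pA.
  - move=> x a y b gx gy; have [A [[_ _ _ pA] gAx gAy AU]] := U2 _ _ _ _ gx gy.
    by apply: AU; apply: pA.
have tot x : exists a, gr A x a.
  have [B [pdB AB [v Bv]]] := partial_derivation_adjoin pdA x.
  pose B' : set (K * K) := fun u => B u.1 u.2.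
  have grB : gr B' = B.
    apply/funext => z; apply/funext => c; apply/propext.
    by split=> [[//|gz]|]; [apply: AB; right | left].
  exists v; apply: contrapT => nAv; apply: (maxA B'); last by rewrite grB.
  split; first by move=> [z c] Azc; apply: AB; left.
  by move=> BA; apply: nAv; left; apply: BA.
have [D AD] := choice tot.
case: (pdA) => A0 A1 AB AM.
have uniqA x a b : gr A x a -> gr A x b -> a = b.
  by move=> ga gb; apply/eqP; rewrite -subr_eq0; apply/eqP/A0; rewrite -(subrr x); apply: AB.
exists D; last by move=> x a ga; apply: uniqA (AD x) _; right.
split=> [x y|x y]; last by apply: uniqA (AD _) _; apply: AM.
by apply: uniqA (AD _) _; apply: (partial_derivationD pdA).
Qed.

End DerivationExtension.

Lemma pchar0_poly (R : idomainType) : [pchar R] =i pred0 -> [pchar {poly R}] =i pred0.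
Proof.
move=> cR; apply/pcharf0P => n.
by rewrite -polyC_natr polyC_eq0 (pcharf0P R).1.
Qed.

Lemma pchar0_rmorph (k K : fieldType) (f : {rmorphism k -> K}) :
  [pchar k] =i pred0 -> [pchar K] =i pred0.
Proof. by move=> ck; apply/pcharf0P => n; rewrite -(rmorph_nat f) fmorph_eq0 (pcharf0P k).1. Qed.

Lemma rmorph_mmap n (R S T : comNzRingType) (f : {rmorphism R -> S})
    (phi : {rmorphism S -> T}) (h : 'I_n -> S) p :
  phi (mmap f h p) = mmap (phi \o f) (phi \o h) p.
Proof.
rewrite /mmap rmorph_sum; apply: eq_bigr => m _; rewrite rmorphM /=; congr (_ * _).
by rewrite /mmap1 rmorph_prod; apply: eq_bigr => i _; rewrite rmorphXn.
Qed.

Lemma mmap_id n (R : comNzRingType) (p : {mpoly R[n]}) :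
  mmap (@mpolyC n R) (fun i => 'X_i) p = p.
Proof.
rewrite [RHS]mpolyE; apply: eq_bigr => m _.
by rewrite mmap1_id mul_mpolyC.
Qed.

Lemma eq_mmap n (R S : nzRingType) (f f' : R -> S) (h h' : 'I_n -> S) p :
  f =1 f' -> h =1 h' -> mmap f h p = mmap f' h' p.
Proof.
by move=> ff' hh'; apply: eq_bigr => m _; rewrite ff'; congr (_ * _); apply: mmap1_eq.
Qed.

(** * Chain rule for polynomials whose coefficients are also derived *)

Section ChainRule.
Variables (A K : comNzRingType) (f : {rmorphism A -> K}).
Variables (d : A -> A) (D : K -> K).
Hypotheses (leibd : leibniz d) (leibD : leibniz D) (Df : forall a, D (f a) = f (d a)).

Lemma coef_map_leibniz p i : (map_poly d p)`_i = d p`_i.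
Proof. by rewrite coef_map_id0 // leibniz0. Qed.

Lemma leibniz_map_poly : leibniz (map_poly d).
Proof.
split=> [p q|p q]; apply/polyP => i.
  by rewrite !(coefD, coef_map_leibniz) leibnizD.
rewrite coefD coef_map_leibniz coefM [q * _]mulrC !coefM leibniz_sum // -big_split.
apply: eq_bigr => j _; rewrite /= leibnizM // !coef_map_leibniz.
by rewrite [_ * d _ as X in _ + X]mulrC.
Qed.

Definition hev (x : K) : {poly A} -> K := horner_morph (fun a => mulrC x (f a)).
HB.instance Definition _ x := GRing.RMorphism.on (hev x).

Lemma hevC x c : hev x c%:P = f c. Proof. exact: horner_morphC. Qed.
Lemma hevX x : hev x 'X = x. Proof. exact: horner_morphX. Qed.

Lemma leibniz_hev x p :
  D (hev x p) = hev x (map_poly d p) + hev x p^`() * D x.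
Proof.
have dMX q : map_poly d (q * 'X) = map_poly d q * 'X.
  by apply/polyP => i; rewrite coef_map_leibniz !coefMX coef_map_leibniz;
     case: (i == 0) => //; rewrite leibniz0.
have dC c : map_poly d c%:P = (d c)%:P.
  by apply/polyP => i; rewrite coef_map_leibniz !coefC;
     case: (i == 0) => //; rewrite leibniz0.
elim/poly_ind: p => [|p c IH].
  by rewrite (leibniz0 leibniz_map_poly) deriv0 !rmorph0 mul0r addr0 leibniz0.
rewrite (leibnizD leibniz_map_poly) dMX dC derivMXaddC.
rewrite !(rmorphD, rmorphM) /= (leibnizD leibD) (leibnizM leibD).
by rewrite !hevC !hevX Df IH; ring.
Qed.

End ChainRule.

(** * Derivations of a function field in one variable *)

Section CurveFunctionField.
Variables (k K : fieldType) (iota : {rmorphism k -> K}).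
Hypothesis chark : [pchar k] =i pred0.
Let charK : [pchar K] =i pred0 := pchar0_rmorph iota chark.

Definition transcendental (s : K) : Prop :=
  forall p : {poly k}, hev iota s p = 0 -> p = 0.

(** The inner variable goes to x and the outer one to y, so that [deriv] differentiates in y. *)
Definition hev2 (x y : K) : {poly {poly k}} -> K := hev (hev iota x) y.
HB.instance Definition _ x y := GRing.RMorphism.on (hev2 x y).

Lemma derivation_leibniz D : derivation iota D -> leibniz D.
Proof. by case. Qed.

Lemma derivation_iota D c : derivation iota D -> D (iota c) = 0.
Proof. by case. Qed.

Lemma leibniz_cst0 (A : nzRingType) : leibniz (fun _ : A => 0).
Proof. by split=> [x y|x y]; rewrite ?mulr0 addr0. Qed.

Lemma leibniz_derivation D : leibniz D -> (forall c, D (iota c) = 0) -> derivation iota D.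
Proof. by case=> ? ? ?; split. Qed.

(** Deriving the coefficients of p and adding p'(s) c is well defined on polynomials in s because s
    is transcendental; [derivation_extension] does the rest. *)
Lemma leibniz_extension (d : k -> k) (s c : K) : leibniz d -> transcendental s ->
  exists D : K -> K, [/\ leibniz D, forall a, D (iota a) = iota (d a) & D s = c].
Proof.
move=> leibd trs.
pose G x a := exists p, x = hev iota s p /\ a = hev iota s (map_poly d p) + hev iota s p^`() * c.
have leibdp := leibniz_map_poly leibd.
have [|D leibD DG] := derivation_extension charK (G := G).
  split.
  - by move=> a [p [/esym/trs -> ->]]; rewrite leibniz0 // deriv0 !rmorph0 mul0r addr0.
  - by exists 1; rewrite leibniz1 // derivC !rmorph0 rmorph1 mul0r addr0.
  - move=> _ _ _ _ [p [-> ->]] [q [-> ->]]; exists (p - q).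
    by rewrite (leibnizB leibdp) derivB !rmorphB; split=> //; ring.
  - move=> _ _ _ _ [p [-> ->]] [q [-> ->]]; exists (p * q).
    rewrite (leibnizM leibdp) derivM !(rmorphD, rmorphM) /=; split=> //. ring.
have dC a : map_poly d a%:P = (d a)%:P.
  by apply/polyP => i; rewrite coef_map_leibniz // !coefC;
     case: (i == 0) => //; rewrite leibniz0.
exists D; split=> // [a|]; apply: DG.
  exists a%:P; rewrite dC derivC !hevC rmorph0 mul0r addr0.
  by split.
exists 'X; rewrite hevX derivX rmorph1 mul1r; split=> //.
rewrite -[map_poly d 'X](_ : 0 = _) ?rmorph0 ?add0r //.
by apply/polyP => i; rewrite coef_map_leibniz // coefX coef0; case: (i == 1)%N;
  rewrite ?leibniz1 ?leibniz0.
Qed.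

End CurveFunctionField.

Lemma rmorph_hev (A B C : comNzRingType) (f : {rmorphism A -> B})
    (phi : {rmorphism B -> C}) x p :
  phi (hev f x p) = hev (phi \o f) (phi x) p.
Proof.
elim/poly_ind: p => [|p c IH]; first by rewrite !rmorph0.
by rewrite !(rmorphD, rmorphM) /= !hevC !hevX IH.
Qed.

Lemma eq_hev (A B : comNzRingType) (f g : {rmorphism A -> B}) x y p :
  f =1 g -> x = y -> hev f x p = hev g y p.
Proof.
move=> fg ->; elim/poly_ind: p => [|p c IH]; first by rewrite !rmorph0.
by rewrite !(rmorphD, rmorphM) /= !hevC !hevX IH fg.
Qed.

Lemma hev_id (A : comNzRingType) (p : {poly A}) : hev (@polyC A) 'X p = p.
Proof.
elim/poly_ind: p => [|p c IH]; first by rewrite !rmorph0.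
by rewrite !(rmorphD, rmorphM) /= !hevC !hevX IH.
Qed.

Section CurveFunctionField.
Variables (k K : fieldType) (iota : {rmorphism k -> K}).
Hypothesis chark : [pchar k] =i pred0.

Hypothesis trdeg1 : has_trdeg iota 1.
Local Notation transc := (transcendental iota).

Lemma exists_transcendental : exists t, transc t.
Proof.
case: trdeg1 => [[a alga] _]; exists (a ord0) => p px.
have E : hev (@mpolyC 1 k) 'X_ord0 p = 0.
  apply: alga; rewrite rmorph_hev -[RHS]px; apply: eq_hev => [c|] /=.
    by rewrite mmapC.
  by rewrite mmapX mmap1U.
have := congr1 (mmap (@polyC k) (fun _ => 'X)) E.
rewrite rmorph0 rmorph_hev => <-; rewrite -[LHS]hev_id.
apply: eq_hev => [c|] /=; first by rewrite mmapC.
by rewrite mmapX mmap1U.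
Qed.

Lemma algebraic_relation x y : exists2 G, G != 0 & hev2 iota x y G = 0.
Proof.
case: trdeg1 => [_ /(_ (fun i : 'I_2 => if i == ord0 then x else y)) nalg].
have [p px pn0] : exists2 p : {mpoly k[2]},
    mmap iota (fun i => if i == ord0 then x else y) p = 0 & p != 0.
  apply: contrapT => np; apply: nalg => p px; apply/eqP.
  by apply: contrapT => /negP pn0; apply: np; exists p.
pose h (i : 'I_2) : {poly {poly k}} := if i == ord0 then 'X%:P else 'X.
pose G := mmap (@polyC _ \o @polyC k) h p.
exists G; last first.
  rewrite /hev2 rmorph_mmap -[RHS]px; apply: eq_mmap => [c|i] /=; first by rewrite hevC /= hevC.
  rewrite /h; case: (i == ord0); first by rewrite hevC /= hevX.
  by rewrite hevX.
apply: contraNneq pn0 => G0.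
(* [psi] undoes the passage from p to G, so G = 0 would give p = 0. *)
pose psi := hev (hev (@mpolyC 2 k) 'X_ord0) 'X_ord_max.
apply/eqP; transitivity (psi G); last by rewrite G0 /psi rmorph0.
rewrite -[LHS]mmap_id /psi /G rmorph_mmap; apply/esym.
apply: eq_mmap => [c|i] /=; first by rewrite hevC /= hevC.
rewrite /h; case: eqP => [->|ni]; first by rewrite hevC /= hevX.
rewrite hevX.
by congr 'X_(_); apply/val_inj; case: i ni => [[|[|]]] //= ? /eqP.
Qed.

(** In a relation of least degree in y the y-derivative cannot vanish at y: being smaller it would
    be 0, G would be constant in y, and s algebraic. *)
Lemma separable_relation s y : transc s ->
  exists2 G, hev2 iota s y G = 0 & hev2 iota s y G^`() != 0.
Proof.
move=> trs; have [G1 G1n0 G1y] := algebraic_relation s y.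
pose P n := `[< exists G, [/\ G != 0, hev2 iota s y G = 0 & size G = n] >].
have exP : exists n, P n by exists (size G1); apply/asboolP; exists G1.
case: (ex_minnP exP) => n /asboolP[G [Gn0 Gy szG]] minP.
exists G => //; apply/eqP => dGy.
have dG0 : G^`() = 0.
  apply/eqP; apply: contraT => dGn0.
  have := minP (size G^`()); rewrite leqNgt -szG lt_size_deriv // => /implyP.
  by rewrite implybF => /asboolP; case; exists G^`().
have := deriv_eq0_size (pchar0_poly chark) dG0 => /size1_polyC GE.
by move: Gn0 Gy; rewrite GE /hev2 hevC polyC_eq0 => /eqP n0 /trs.
Qed.

(** Powers of the outer variable dividing G can be cancelled because y is nonzero. *)
Lemma relation_coef0_neq0 s y : y != 0 ->
  exists2 G, hev2 iota s y G = 0 & G`_0 != 0.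
Proof.
move=> yn0; have [G1 G1n0 G1y] := algebraic_relation s y.
have [n] := ubnP (size G1); elim: n G1 G1n0 G1y => // n IH G Gn0 Gy.
rewrite ltnS => leG; have [G0|] := eqVneq G`_0 0; last by exists G.
have [|G' GE] := factor_theorem G 0 _.
  by rewrite /root horner_coef0 G0.
rewrite subr0 in GE; have G'n0 : G' != 0 by apply: contraNneq Gn0 => G'0; rewrite GE G'0 mul0r.
apply: (IH G') => //.
  by move: Gy; rewrite GE rmorphM /= /hev2 hevX => /eqP; rewrite mulf_eq0 (negPf yn0) orbF => /eqP.
by move: leG; rewrite GE size_mulX.
Qed.

(** D vanishes on k[x], so the chain rule applied to a separable relation G(x, y) = 0 leaves G_y(x,
    y) D y = 0. *)
Lemma derivation_eq0 D x y : derivation iota D -> transc x -> D x = 0 -> D y = 0.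
Proof.
move=> derD trx Dx0; have leibD := derivation_leibniz derD.
have [G Gy dGy] := separable_relation y trx.
have leib0 (A : nzRingType) := leibniz_cst0 A.
have Dh p : D (hev iota x p) = hev iota x 0.
  rewrite (leibniz_hev (leib0 k) leibD) ?Dx0 ?mulr0 ?addr0 => [|c].
    by congr (hev _ _ _); apply/polyP => i; rewrite coef_map_leibniz // coef0.
  by rewrite (derivation_iota _ derD) rmorph0.
have := leibniz_hev (leib0 {poly k}) leibD Dh y G; rewrite -/(hev2 iota x y) Gy leibniz0 //.
rewrite (_ : map_poly _ _ = 0); last by apply/polyP => i; rewrite coef_map_leibniz // coef0.
by rewrite rmorph0 add0r => /esym/eqP; rewrite mulf_eq0 (negPf dGy) => /eqP.
Qed.

Lemma derivation_algebraic D x : derivation iota D -> ~ transc x -> D x = 0.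
Proof.
move=> derD ntx; have leibD := derivation_leibniz derD.
have [p1 p1x p1n0] : exists2 p, hev iota x p = 0 & p != 0.
  by apply: contrapT => np; apply: ntx => p px; apply/eqP;
     apply: contrapT => /negP ?; apply: np; exists p.
pose P n := `[< exists p, [/\ p != 0, hev iota x p = 0 & size p = n] >].
have exP : exists n, P n by exists (size p1); apply/asboolP; exists p1.
case: (ex_minnP exP) => n /asboolP[p [pn0 px szp]] minP.
have dpx : hev iota x p^`() != 0.
  apply/eqP => dpx; have dp0 : p^`() = 0.
    apply/eqP; apply: contraT => dpn0.
    have := minP (size p^`()); rewrite leqNgt -szp lt_size_deriv // => /implyP.
    by rewrite implybF => /asboolP; case; exists p^`().
  move: pn0 px; rewrite (size1_polyC (deriv_eq0_size chark dp0)) hevC polyC_eq0.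
  by move=> cn0 /eqP; rewrite fmorph_eq0 (negPf cn0).
have Diota c : D (iota c) = iota 0 by rewrite (derivation_iota c derD) rmorph0.
have := leibniz_hev (leibniz_cst0 k) leibD Diota x p; rewrite px leibniz0 //.
rewrite (_ : map_poly _ _ = 0); last first.
  by apply/polyP => i; rewrite coef_map_leibniz ?coef0 //; apply: leibniz_cst0.
by rewrite rmorph0 add0r => /esym/eqP; rewrite mulf_eq0 (negPf dpx) => /eqP.
Qed.

(** The derivations over k form a space of dimension at most 1: D x D' - D' x D kills x, hence
    everything if x is transcendental. For x algebraic both sides are 0. *)
Lemma derivation_proportional D D' x y : derivation iota D -> derivation iota D' ->
  D x * D' y = D y * D' x.
Proof.
move=> derD derD'.
have [trx|/derivation_algebraic alx] := pselect (transc x); last by rewrite !alx // mul0r mulr0.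
pose E z := D x * D' z - D' x * D z.
have derE : derivation iota E.
  have [lD lD'] := (derivation_leibniz derD, derivation_leibniz derD').
  rewrite /E; split.
  - by move=> a b; rewrite (leibnizD lD) (leibnizD lD'); ring.
  - by move=> a b; rewrite (leibnizM lD) (leibnizM lD'); ring.
  - by move=> c; rewrite (derivation_iota c derD) (derivation_iota c derD') !mulr0 subr0.
have Ex : E x = 0 by rewrite /E mulrC subrr.
have := derivation_eq0 y derE trx Ex.
by rewrite /E => /eqP; rewrite subr_eq0 [D' x * _]mulrC => /eqP.
Qed.

End CurveFunctionField.

(** * Valuation rings of a function field in one variable *)

Lemma hev_cons (A B : comNzRingType) (f : {rmorphism A -> B}) x (p : {poly A}) :
  exists q : {poly A}, p = q * 'X + (p`_0)%:P /\ hev f x p = f p`_0 + x * hev f x q.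
Proof.
elim/poly_ind: p => [|p c _]; first by exists 0; rewrite coef0 mul0r !rmorph0 mulr0 !addr0.
exists p; rewrite coefD coefMX coefC add0r /=; split=> //.
by rewrite rmorphD rmorphM /= hevC hevX addrC mulrC.
Qed.

Section ValuationRing.
Variables (k : closedFieldType) (K : fieldType) (iota : {rmorphism k -> K}).
Hypothesis chark : [pchar k] =i pred0.
Hypothesis trdeg1 : has_trdeg iota 1.
Variable O : {pred K}.
Hypothesis valO : valuation_ring iota O.

(** The maximal ideal of [O], that is, the elements of positive value. *)
Definition val_ideal (x : K) : bool := (x == 0) || (x^-1 \notin O).

Lemma valring1 : 1 \in O. Proof. by case: valO => -[]. Qed.
Lemma valringB x y : x \in O -> y \in O -> x - y \in O.
Proof. by case: valO => -[_ + _] _ _ _; apply. Qed.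
Lemma valringM x y : x \in O -> y \in O -> x * y \in O.
Proof. by case: valO => -[_ _ +] _ _ _; apply. Qed.
Lemma valring_iota c : iota c \in O. Proof. by case: valO. Qed.
Lemma valringV x : x \notin O -> x^-1 \in O. Proof. by case: valO => _ _ _; apply. Qed.
Lemma valring0 : 0 \in O. Proof. by rewrite -(rmorph0 iota) valring_iota. Qed.
Lemma valringN x : x \in O -> - x \in O.
Proof. by move=> Ox; rewrite -sub0r; apply: valringB => //; apply: valring0. Qed.
Lemma valringD x y : x \in O -> y \in O -> x + y \in O.
Proof. by move=> Ox Oy; rewrite -[y]opprK; apply: valringB => //; apply: valringN. Qed.
Lemma valringX x n : x \in O -> x ^+ n \in O.
Proof.
move=> Ox; elim: n => [|n IH]; first by rewrite expr0 valring1.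
by rewrite exprS valringM.
Qed.
Lemma valring_sum I (r : seq I) (P : pred I) (f : I -> K) :
  (forall i, P i -> f i \in O) -> \sum_(i <- r | P i) f i \in O.
Proof.
move=> Of; elim/big_ind: _ => //; [exact: valring0 | exact: valringD].
Qed.
Lemma valring_prod I (r : seq I) (P : pred I) (f : I -> K) :
  (forall i, P i -> f i \in O) -> \prod_(i <- r | P i) f i \in O.
Proof.
move=> Of; elim/big_ind: _ => //; [exact: valring1 | exact: valringM].
Qed.

Lemma valring_hev (A : comNzRingType) (f : {rmorphism A -> K}) x p :
  (forall a, f a \in O) -> x \in O -> hev f x p \in O.
Proof.
move=> Of Ox; elim/poly_ind: p => [|p c IH]; first by rewrite rmorph0 valring0.
by rewrite rmorphD rmorphM /= hevC hevX valringD ?valringM.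
Qed.

Lemma valring_hev1 x p : x \in O -> hev iota x p \in O.
Proof. by apply: valring_hev => c; apply: valring_iota. Qed.

Lemma valring_hev2 x y G : x \in O -> y \in O -> hev2 iota x y G \in O.
Proof. by move=> Ox; apply: valring_hev => c; apply: valring_hev1. Qed.

Lemma val_ideal_valring x : val_ideal x -> x \in O.
Proof.
case/predU1P => [->|/valringV]; first exact: valring0.
by rewrite invrK.
Qed.

Lemma val_idealF x : val_ideal x = false -> x != 0 /\ x^-1 \in O.
Proof. by move/negbT; rewrite negb_or negbK => /andP. Qed.

Lemma val_idealM x y : val_ideal x -> y \in O -> val_ideal (x * y).
Proof.
rewrite /val_ideal; have [->|xn0] := eqVneq x 0; first by rewrite mul0r eqxx.
have [->|yn0] := eqVneq y 0; first by rewrite mulr0 eqxx.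
move=> /= xO Oy; rewrite mulf_eq0 (negPf xn0) (negPf yn0) /=.
apply: contra xO => xyO; rewrite (_ : x^-1 = y * (x * y)^-1) ?valringM //.
by rewrite invfM mulrCA mulfV // mulr1.
Qed.

Lemma val_ideal_div x y : x != 0 -> y != 0 -> (x / y \in O) || (y / x \in O).
Proof.
move=> xn0 yn0; case: (boolP (x / y \in O)) => //= /valringV.
by rewrite invf_div.
Qed.

Lemma val_idealD x y : val_ideal x -> val_ideal y -> val_ideal (x + y).
Proof.
have [->|xn0] := eqVneq x 0; first by rewrite add0r.
have [->|yn0] := eqVneq y 0; first by rewrite addr0.
move=> mx my; case/orP: (val_ideal_div xn0 yn0) => Oxy.
  rewrite (_ : x + y = y * (x / y + 1)); first by rewrite val_idealM // valringD // valring1.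
  by rewrite mulrDr mulr1 mulrC divfK.
rewrite (_ : x + y = x * (1 + y / x)); first by rewrite val_idealM // valringD // valring1.
by rewrite mulrDr mulr1 [x * (_ / _)]mulrC divfK.
Qed.

Lemma val_ideal_sum I (r : seq I) (P : pred I) (f : I -> K) :
  (forall i, P i -> val_ideal (f i)) -> val_ideal (\sum_(i <- r | P i) f i).
Proof.
move=> Of; elim/big_ind: _ => //; [by rewrite /val_ideal eqxx | exact: val_idealD].
Qed.

Lemma val_ideal_prime x y : val_ideal (x * y) -> val_ideal x || val_ideal y.
Proof.
case: (boolP (val_ideal x)) => //= /negbTE/val_idealF[xn0 Ox] mxy.
rewrite -[y](mulKf xn0) mulrC; exact: val_idealM.
Qed.

Lemma val_ideal1 : ~~ val_ideal 1.
Proof. by rewrite /val_ideal oner_eq0 invr1 valring1. Qed.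

Lemma val_ideal_iota c : val_ideal (iota c) = (c == 0).
Proof.
have [->|cn0] := eqVneq c 0; first by rewrite rmorph0 /val_ideal eqxx.
by rewrite /val_ideal fmorph_eq0 (negPf cn0) -fmorphV valring_iota.
Qed.

Lemma val_ideal_neq0_exists : exists2 t, t != 0 & val_ideal t.
Proof.
case: valO => _ _ [x Ox] _; exists x^-1; last by rewrite /val_ideal invrK Ox orbT.
by rewrite invr_eq0; apply: contraNneq Ox => ->; rewrite valring0.
Qed.

(** The residue field is k because k is algebraically closed: a relation G(x, t) = 0 with t in the
    maximal ideal puts the value at x of the nonzero polynomial G_0 there, hence, by primality, one
    of its linear factors. *)
Lemma val_residue x : x \in O -> exists c, val_ideal (x - iota c).
Proof.
move=> Ox; have [t tn0 mt] := val_ideal_neq0_exists.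
have Ot := val_ideal_valring mt.
have [G Gxt G0n0] := relation_coef0_neq0 trdeg1 x tn0.
have [q [_]] := hev_cons (hev iota x) t G; rewrite -/(hev2 iota x t G) Gxt => E.
have {E} : val_ideal (hev iota x G`_0).
  move/esym/eqP: E; rewrite addr_eq0 -mulrN => /eqP ->.
  by apply: val_idealM => //; apply/valringN/valring_hev2.
have [r GE] := closed_field_poly_normal G`_0.
rewrite {1}GE -mul_polyC rmorphM /= hevC => /val_ideal_prime.
rewrite val_ideal_iota lead_coef_eq0 (negPf G0n0) /= {GE}.
elim: r => [|c r IH]; first by rewrite big_nil rmorph1 (negPf val_ideal1).
rewrite big_cons rmorphM rmorphB /= hevX hevC => /val_ideal_prime/orP[mc|/IH//].
by exists c.
Qed.

Section Uniformizer.
Variable s : K.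
Hypotheses (sn0 : s != 0) (ms : val_ideal s).
Let Os : s \in O := val_ideal_valring ms.

(** Once the powers of X are split off p, the constant term is nonzero, and a nonzero constant plus
    a multiple of s is a unit. *)
Lemma hev_val_parameter p : p != 0 ->
  exists j u, [/\ hev iota s p = s ^+ j * u, u \in O & ~~ val_ideal u].
Proof.
elim/poly_ind: p => [|p c IH]; first by rewrite eqxx.
have [->|cn0] := eqVneq c 0.
  rewrite addr0 => pn0; have [|j [u [E Ou mu]]] := IH.
    by apply: contraNneq pn0 => ->; rewrite mul0r.
  by exists j.+1, u; rewrite rmorphM /= hevX E exprSr mulrAC.
move=> _; exists 0%N, (hev iota s (p * 'X + c%:P)); rewrite expr0 mul1r.
split=> //; first exact: valring_hev1.
rewrite rmorphD rmorphM /= hevX hevC; apply/negP => mh.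
have : val_ideal (hev iota s p * s + iota c + s * (- hev iota s p)).
  by apply: val_idealD => //; apply: val_idealM => //; apply/valringN/valring_hev1.
by rewrite mulrN mulrC addrAC addrN add0r val_ideal_iota (negPf cn0).
Qed.

Lemma val_parameter_transcendental : transcendental iota s.
Proof.
move=> p ps; apply/eqP; apply: contraTT isT => /hev_val_parameter[j [u [E _]]].
move: E; rewrite ps => /esym/eqP; rewrite mulf_eq0 expf_eq0 (negPf sn0) andbF /=.
by move=> /eqP ->; rewrite /val_ideal eqxx.
Qed.

(** For g in O, the constant term in g of a relation between s and g is s^j times a unit, and it is
    also a multiple of g in O. *)
Lemma val_archimedean g : g != 0 -> exists N, s ^+ N / g \in O.
Proof.
move=> gn0; case: (boolP (g \in O)) => [Og|/valringV Og]; last first.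
  by exists 0%N; rewrite expr0 mul1r.
have [G Gsg G0n0] := relation_coef0_neq0 trdeg1 s gn0.
have [q [_]] := hev_cons (hev iota s) g G; rewrite -/(hev2 iota s g G) Gsg => E.
have [j [u [E1 _ /negbTE/val_idealF[un0 Ou]]]] := hev_val_parameter G0n0.
exists j; rewrite (_ : s ^+ j / g = - hev2 iota s g q / u).
  by rewrite valringM // valringN // valring_hev2.
apply: (mulIf un0); rewrite divfK //; apply: (mulfI gn0).
rewrite mulrAC mulrCA mulfV // mulr1 -E1.
by move/esym/eqP: E; rewrite addr_eq0 -mulrN => /eqP.
Qed.

Hypothesis unif : forall x, val_ideal x -> x / s \in O.

(** A truncated s-adic expansion: subtract the residue, divide by s, repeat. *)
Lemma val_approximation x N : x \in O ->
  exists p y, x = hev iota s p + s ^+ N * y /\ y \in O.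
Proof.
elim: N x => [|N IH] x Ox; first by exists 0, x; rewrite rmorph0 add0r expr0 mul1r.
have [c mx] := val_residue Ox.
have [p [y [E Oy]]] := IH _ (unif mx).
exists (p * 'X + c%:P), y; split=> //.
rewrite rmorphD rmorphM /= hevX hevC exprSr mulrAC addrAC -mulrDl -E divfK //.
by rewrite subrK.
Qed.

Variables (d : k -> k) (D : K -> K).
Hypotheses (leibd : leibniz d) (leibD : leibniz D).
Hypotheses (Diota : forall c, D (iota c) = iota (d c)) (Ds : D s = 0).

Let Dhev p : D (hev iota s p) = hev iota s (map_poly d p).
Proof. by rewrite (leibniz_hev leibd leibD) // Ds mulr0 addr0. Qed.

(** Since D s = 0, D acts on the coefficients alone; p(s) / s^N in O means that X^N divides p, which
    is preserved. *)
Lemma leibniz_hev_parameter p N : hev iota s p / s ^+ N \in O ->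
  D (hev iota s p) / s ^+ N \in O.
Proof.
elim/poly_ind: p N => [|p c IH] N; first by rewrite rmorph0 leibniz0.
case: N => [|N]; first by rewrite expr0 divr1 Dhev divr1 => _; apply: valring_hev1.
move=> OpN; have c0 : c = 0.
  apply/eqP; rewrite -val_ideal_iota.
  rewrite (_ : iota c = s * (s ^+ N * (hev iota s (p * 'X + c%:P) / s ^+ N.+1) - hev iota s p)).
    by rewrite val_idealM // valringB // ?valring_hev1 // valringM // valringX.
  rewrite mulrBr mulrA -exprS mulrC divfK ?expf_neq0 //.
  by rewrite rmorphD rmorphM /= hevX hevC [s * _]mulrC addrAC addrN add0r.
move: OpN; rewrite c0 addr0 rmorphM /= hevX exprSr (leibnizM leibD) Ds mulr0 add0r.
rewrite invfM mulrA mulrAC mulfK // => /IH.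
by rewrite mulrA mulrAC [s * _]mulrC mulfK.
Qed.

Lemma valring_hev_sub (A : comNzRingType) (f : {rmorphism A -> K}) x z p :
  (forall a, f a \in O) -> x \in O -> z \in O ->
  exists2 h, h \in O & hev f x p - hev f z p = (x - z) * h.
Proof.
move=> Of Ox Oz; elim/poly_ind: p => [|p c [h Oh E]].
  by exists 0; rewrite ?valring0 // !rmorph0 subrr mulr0.
exists (h * x + hev f z p); first by rewrite valringD ?valringM // valring_hev.
rewrite !rmorphD !rmorphM /= !hevX !hevC mulrDr mulrA -E; ring.
Qed.

(* Modulo high powers of s, f is a polynomial in s, and D preserves divisibility
   by s ^+ N of such polynomials; the separable relation G(s, f) = 0 transfers
   this to f. *)
Lemma leibniz_valring f : f \in O -> D f \in O.
Proof.
move=> Of; have trs := val_parameter_transcendental.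
have [G Gf dGf] := separable_relation chark trdeg1 f trs.
have [N ON] := val_archimedean dGf.
have [p [y [fE Oy]]] := val_approximation N Of.
have Ohev q : hev iota s q \in O by apply: valring_hev1.
pose fN := hev iota s p; have OfN : fN \in O := Ohev p.
have sNn0 : s ^+ N != 0 by rewrite expf_neq0.
have near H : exists2 h, h \in O & hev2 iota s f H - hev2 iota s fN H = s ^+ N * h.
  have [h Oh E] := valring_hev_sub H Ohev Of OfN.
  exists (y * h); first exact: valringM.
  by rewrite E fE mulrA [_ + _ - _]addrAC subrr add0r.
have chain x := leibniz_hev (leibniz_map_poly leibd) leibD Dhev x G.
have := chain fN; have := chain f; rewrite -!/(hev2 iota s _ _) Gf leibniz0 //.
set Gd := map_poly _ G => E1 E2.
have [h1 Oh1 F1] := near G; have [h2 Oh2 F2] := near Gd; have [h3 Oh3 F3] := near G^`().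
have ODG : D (hev2 iota s fN G) / s ^+ N \in O.
  have E : hev2 iota s fN G = hev iota s (hev idfun p G).
    by rewrite [RHS](rmorph_hev idfun (hev iota s) p G); apply: eq_hev.
  rewrite E; apply: leibniz_hev_parameter; rewrite -E.
  move: F1; rewrite Gf sub0r => /eqP; rewrite eqr_oppLR => /eqP ->.
  by rewrite -mulrN mulrC mulKf // valringN.
have DfN : D fN \in O by rewrite Dhev.
(* The chain rules at f and at its truncation [fN], subtracted and divided by G_y(s, f); N was
   chosen so that s^N / G_y(s, f) lies in O. *)
have -> : D f = D fN + s ^+ N / hev2 iota s f G^`() *
    (- (D (hev2 iota s fN G) / s ^+ N) - h2 - h3 * D fN).
  apply: (mulfI dGf); rewrite mulrDr mulrA [_ * (_ / _)]mulrC divfK //.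
  rewrite !mulrBr mulrN [s ^+ N * (_ / _)]mulrC divfK // mulrA -F2 -F3 E2.
  move/esym/eqP: E1; rewrite addr_eq0 => /eqP E1; rewrite -[LHS]opprK -E1; ring.
rewrite valringD // valringM // valringB ?valringM // valringB // valringN //.
Qed.

End Uniformizer.
End ValuationRing.

(** * Finiteness of K over k(t) *)

Lemma linear_dependence (F : fieldType) (K : comNzRingType) (f : {rmorphism F -> K})
    (I : finType) (e : I -> K) (C : 'I_#|I|.+1 -> I -> F) :
  exists2 v : 'I_#|I|.+1 -> F, exists i, v i != 0 &
    \sum_i f (v i) * (\sum_j f (C i j) * e j) = 0.
Proof.
pose A := \matrix_(i < #|I|.+1, j < #|I|) C i (enum_val j).
have : kermx A != 0.
  rewrite kermx_eq0 /row_free neq_ltn; apply/orP; left.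
  by rewrite ltnS rank_leq_col.
case/rowV0Pn => v /sub_kermxP vA vn0.
exists (v 0).
  case/rV0Pn: vn0 => i vi; by exists i.
under eq_bigr do rewrite mulr_sumr.
rewrite exchange_big big1 // => j _ /=.
have E : \sum_i v 0 i * C i j = 0.
  have := congr1 (fun M : 'rV_ _ => M 0 (enum_rank j)) vA; rewrite !mxE => E.
  by rewrite -[RHS]E; apply: eq_bigr => i _; rewrite mxE enum_rankK.
transitivity (f (\sum_i v 0 i * C i j) * e j); last by rewrite E rmorph0 mul0r.
by rewrite rmorph_sum mulr_suml; apply: eq_bigr => i _; rewrite rmorphM mulrA.
Qed.

Section RationalSubfield.
Variables (k K : fieldType) (iota : {rmorphism k -> K}) (t : K).

Definition rational_in : {pred K} :=
  fun x => `[< exists p q, hev iota t q != 0 /\ x = hev iota t p / hev iota t q >].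

Lemma rational_in_divring_closed : divring_closed rational_in.
Proof.
split.
- by apply/asboolP; exists 1, 1; rewrite rmorph1 divr1 oner_eq0.
- move=> _ _ /asboolP[p [q [qn0 ->]]] /asboolP[p' [q' [qn0' ->]]].
  apply/asboolP; exists (p * q' - p' * q), (q * q').
  rewrite rmorphB !rmorphM /= mulf_neq0 //; split=> //.
  by field; rewrite qn0 qn0'.
- move=> _ _ /asboolP[p [q [qn0 ->]]] /asboolP[p' [q' [qn0' ->]]].
  apply/asboolP; have [p0|pn0] := eqVneq (hev iota t p') 0.
    by exists 0, 1; rewrite p0 mul0r invr0 mulr0 rmorph0 rmorph1 mul0r oner_eq0.
  exists (p * q'), (q * p'); rewrite !rmorphM /= mulf_neq0 //; split=> //.
  by rewrite invf_div mulf_div.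
Qed.

HB.instance Definition _ := GRing.isDivringClosed.Build _ rational_in
  rational_in_divring_closed.

Definition rational_subfield : fieldType := subfield_of rational_in.

Definition rational_incl : {rmorphism rational_subfield -> K} :=
  [the {rmorphism _ -> _} of (val : rational_subfield -> K)].

Lemma rational_inclP (v : rational_subfield) :
  exists p q, hev iota t q != 0 /\ rational_incl v = hev iota t p / hev iota t q.
Proof. by case: v => x xin; apply/asboolP. Qed.

Lemma rational_in_hev p : hev iota t p \in rational_in.
Proof. by apply/asboolP; exists p, 1; rewrite rmorph1 divr1 oner_eq0. Qed.

Definition rational_of (p : {poly k}) : rational_subfield :=
  SubField (rational_in_hev p).

Lemma rational_ofE p : rational_incl (rational_of p) = hev iota t p.
Proof. by []. Qed.

Lemma rational_of_zmod : zmod_morphism rational_of.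
Proof. by move=> p q; apply: val_inj; rewrite /= rmorphB. Qed.
Lemma rational_of_monoid : monoid_morphism rational_of.
Proof. by split=> [|p q]; apply: val_inj; rewrite /= ?rmorph1 ?rmorphM. Qed.
HB.instance Definition _ := GRing.isZmodMorphism.Build {poly k} rational_subfield
  rational_of rational_of_zmod.
HB.instance Definition _ := GRing.isMonoidMorphism.Build {poly k} rational_subfield
  rational_of rational_of_monoid.

End RationalSubfield.

Lemma hev_coef (A B : comNzRingType) (f : {rmorphism A -> B}) x (p : {poly A}) n :
  (size p <= n)%N -> hev f x p = \sum_(j < n) f p`_j * x ^+ j.
Proof.
move=> lepn; rewrite /hev /horner_morph (@horner_coef_wide _ n).
  by apply: eq_bigr => j _; rewrite coef_map.
by apply: leq_trans lepn; apply: size_poly.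
Qed.

Section FiniteOverParameter.
Variables (k K : fieldType) (iota : {rmorphism k -> K}).
Hypothesis trdeg1 : has_trdeg iota 1.
Variable t : K.
Hypothesis trt : transcendental iota t.
Variables (n : nat) (X : 'I_n -> K).

Local Notation F := (rational_subfield iota t).
Local Notation incl := (rational_incl iota t).

Lemma algebraic_over_rational x : exists2 P : {poly F}, P != 0 & hev incl x P = 0.
Proof.
have [G Gn0 Gx] := algebraic_relation trdeg1 t x.
exists (map_poly (rational_of iota t) G); last first.
  rewrite -[RHS]Gx /hev2 (@hev_coef _ _ _ _ _ (size G)) ?size_poly //.
  rewrite (@hev_coef _ _ _ _ G (size G)) //.
  by apply: eq_bigr => i _; rewrite coef_map.
apply: contraNneq Gn0 => G0; apply/eqP/polyP => i; rewrite coef0.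
apply: trt; rewrite -rational_ofE; move: (congr1 (fun P : {poly F} => P`_i) G0).
by rewrite coef_map coef0 => E; apply: etrans (congr1 incl E) (rmorph0 _).
Qed.

(** Each X i is a root of a nonzero P i over k(t), so its powers reduce modulo P i, and the
    monomials with all exponents below D suffice. *)
Lemma finite_over_rational : exists (I : finType) (e : I -> K),
  forall p : {mpoly k[n]}, exists C : I -> F, mmap iota X p = \sum_j incl (C j) * e j.
Proof.
have /choice[P PX] : forall i, exists P : {poly F}, P != 0 /\ hev incl (X i) P = 0.
  by move=> i; have [P] := algebraic_over_rational (X i); exists P.
pose D := (\max_i size (P i))%N.
pose c i m (j : 'I_D) := ('X^m %% P i)`_j.
have Xpow i m : X i ^+ m = \sum_(j < D) incl (c i m j) * X i ^+ j.
  have [Pn0 Px] := PX i.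
  rewrite -(hev_coef incl (X i) (p := 'X^m %% P i)); last first.
    by apply: leq_trans (leq_bigmax i); apply/ltnW; rewrite ltn_modp.
  have := congr1 (hev incl (X i)) (divp_eq 'X^m (P i)).
  by rewrite rmorphD rmorphM /= Px mulr0 add0r rmorphXn /= hevX.
exists {ffun 'I_n -> 'I_D}, (fun phi : {ffun 'I_n -> 'I_D} => \prod_i X i ^+ phi i) => p.
exists (fun phi : {ffun 'I_n -> 'I_D} =>
  \sum_(m <- msupp p) rational_of iota t (p@_m)%:P * \prod_i c i (m i) (phi i)).
transitivity (\sum_(m <- msupp p) \sum_(phi : {ffun 'I_n -> 'I_D})
    incl (rational_of iota t (p@_m)%:P * \prod_i c i (m i) (phi i)) * \prod_i X i ^+ phi i).
  apply: eq_bigr => m _; rewrite /mmap1 (eq_bigr _ (fun i _ => Xpow i (m i))).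
  rewrite bigA_distr_bigA mulr_sumr; apply: eq_bigr => phi _.
  by rewrite rmorphM rmorph_prod big_split mulrA rational_ofE hevC.
by rewrite exchange_big; apply: eq_bigr => phi _; rewrite rmorph_sum mulr_suml.
Qed.

Hypothesis genX : forall x, exists f g : {mpoly k[n]},
  mmap iota X g != 0 /\ x = mmap iota X f / mmap iota X g.

(** The degree of K over k(t) is finite, stated with polynomial coefficients: H clears the
    denominators of the g i, and Q those of the v i. *)
Lemma parameter_dependence : exists N, forall g : 'I_N.+1 -> K,
  exists2 a : 'I_N.+1 -> {poly k}, exists i, a i != 0 &
    \sum_i hev iota t (a i) * g i = 0.
Proof.
have [I [e eP]] := finite_over_rational; exists #|I| => g.
have [f1 f1P] := choice (fun i => genX (g i)); have [h1 gE] := choice f1P.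
pose H := \prod_i mmap iota X (h1 i).
have Hn0 : H != 0 by apply/prodf_neq0 => i _; case: (gE i).
have /choice[C CP] : forall i, exists C : I -> F, H * g i = \sum_j incl (C j) * e j.
  move=> i; have [C CE] := eP (f1 i * \prod_(l | l != i) h1 l).
  exists C; rewrite -CE rmorphM rmorph_prod /H (bigD1 i) //=.
  by have [hn0 ->] := gE i; field.
have [v [i0 vn0] E] := linear_dependence incl e C.
have [p vP] := choice (fun i => rational_inclP (v i)); have [q vE] := choice vP.
pose Q := \prod_i q i.
have Qn0 : hev iota t Q != 0 by rewrite rmorph_prod; apply/prodf_neq0 => i _; case: (vE i).
have aE i : hev iota t (p i * \prod_(l | l != i) q l) = hev iota t Q * incl (v i).
  have -> : Q = q i * \prod_(l | l != i) q l by rewrite /Q (bigD1 i).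
  have [qn0 ->] := vE i; rewrite !rmorphM /=.
  by field.
exists (fun i => p i * \prod_(l | l != i) q l).
  exists i0; apply: contraNneq vn0 => a0; have := aE i0; rewrite a0 rmorph0.
  by move=> /esym/eqP; rewrite mulf_eq0 (negPf Qn0) fmorph_eq0.
apply: (mulfI Hn0); rewrite mulr0.
transitivity (hev iota t Q * \sum_i incl (v i) * (H * g i)).
  rewrite !mulr_sumr; apply: eq_bigr => i _; rewrite aE.
  by rewrite mulrCA -!mulrA.
under eq_bigr do rewrite CP.
by rewrite E mulr0.
Qed.

End FiniteOverParameter.

(** A single number codes the lexicographic order on pairs with second entry at most N, so that one
    minimum can pick the dominant term of a relation. *)
Lemma lexicographic_code N a b r s :
  (a * N.+1 + r <= b * N.+1 + s)%N -> (s <= N)%N -> (a <= b)%N.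
Proof. nia. Qed.

(** * Existence of uniformizers *)

Section UniformizerExistence.
Variables (k : closedFieldType) (K : fieldType) (iota : {rmorphism k -> K}).
Hypothesis chark : [pchar k] =i pred0.
Hypothesis trdeg1 : has_trdeg iota 1.
Variables (n : nat) (X : 'I_n -> K).
Hypothesis genX : forall x, exists f g : {mpoly k[n]},
  mmap iota X g != 0 /\ x = mmap iota X f / mmap iota X g.
Variable O : {pred K}.
Hypothesis valO : valuation_ring iota O.

(* A strictly increasing chain of principal ideals above t = f 0 would give
   elements f i with values in [0, v(t)[, and such elements are linearly
   independent over k(t). *)
Lemma exists_uniformizer : exists s, [/\ s != 0, val_ideal O s &
  forall x, val_ideal O x -> x / s \in O].
Proof.
apply: contrapT => nos.
have [t tn0 mt] := val_ideal_neq0_exists valO.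
have [N dep] := parameter_dependence trdeg1 (val_parameter_transcendental valO tn0 mt) genX.
(* If x is no uniformizer, some y in the maximal ideal has y / x outside O, so its value is strictly
   smaller. *)
have next x : exists y, x != 0 -> val_ideal O x ->
    [/\ y != 0, val_ideal O y & val_ideal O (x / y)].
  apply: contrapT => nx; apply: nos; exists x; split.
  - by apply: contrapT => x0; apply: nx; exists 0.
  - by apply: contrapT => mx; apply: nx; exists 0.
  move=> y my; apply: contrapT => yx; apply: nx; exists y => _ _.
  have Oyx : y / x \notin O by apply/negP.
  split=> //; last by rewrite /val_ideal invf_div Oyx orbT.
  by apply: contraNneq Oyx => ->; rewrite mul0r (valring0 valO).
have [nx nxP] := choice next.
pose f i := iter i nx t.
have fP i : f i != 0 /\ val_ideal O (f i).
  by elim: i => [|i [IH1 IH2]] //=; have [] := nxP _ IH1 IH2.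
have fn0 i : f i != 0 by case: (fP i).
have mf i : val_ideal O (f i) by case: (fP i).
have fS i j : (i < j)%N -> val_ideal O (f i / f j).
  elim: j => // j IH; rewrite ltnS leq_eqVlt => /predU1P[->|ij].
    by have [] := nxP _ (fn0 j) (mf j).
  rewrite (_ : f i / f j.+1 = f i / f j * (f j / f j.+1)); last by rewrite mulrA divfK.
  apply: (val_idealM valO (IH ij)); apply: (val_ideal_valring valO).
  by have [] := nxP _ (fn0 j) (mf j).
have f0 : f 0%N = t by []; clearbody f.
have [a [i1 ai1] E] := dep (fun i => f i.+1).
have /choice[ju juP] : forall i, exists ju : nat * K, a i != 0 ->
    [/\ hev iota t (a i) = t ^+ ju.1 * ju.2, ju.2 \in O & ~~ val_ideal O ju.2].
  move=> i; have [_|ain0] := eqVneq (a i) 0; first by exists (0%N, 0).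
  by have [j [u ?]] := hev_val_parameter valO mt ain0; exists (j, u).
pose J i := (ju i).1; pose u i := (ju i).2.
(* The term of least value: the exponent of t decides first, since the values of the [f i.+1] lie
   strictly between 0 and that of t; then the largest index, since these values decrease. *)
case: (@arg_minnP _ i1 (fun i => a i != 0) (fun i => (J i * N.+1 + (N - i))%N) ai1).
move=> i ain0 minJ.
have [ai _ ui] := juP i ain0; move: ai ui; rewrite -/(J i) -/(u i) => ai /negbTE ui.
have [un0 Ou] := val_idealF ui.
have main : t ^+ J i * u i * f i.+1 != 0 by rewrite !mulf_neq0 ?expf_neq0.
have := E; rewrite (bigD1 i) //= ai => /(congr1 (fun z => z / (t ^+ J i * u i * f i.+1))).
rewrite mul0r mulrDl divff // => /eqP; rewrite addr_eq0 => /eqP E1.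
(* Divided by the dominant term, the relation puts 1 in the maximal ideal. *)
apply: (negP (val_ideal1 valO)); rewrite E1 -mulrN1.
apply: (val_idealM valO); last by rewrite (valringN valO) ?(valring1 valO).
rewrite mulr_suml; apply: (val_ideal_sum valO) => l neql.
have [->|aln0] := eqVneq (a l) 0; first by rewrite rmorph0 !mul0r /val_ideal eqxx.
have [al Oul _] := juP l aln0; move: al Oul; rewrite -/(J l) -/(u l) => -> Oul.
have := minJ l aln0; move: (ltn_ord l) (ltn_ord i) => lN iN le_code.
have [Jl|Jl] := eqVneq (J l) (J i).
  have li : (l < i)%N.
    by move: le_code neql; rewrite Jl leq_add2l leq_sub2lE // -val_eqE ltn_neqAle => -> ->.
  rewrite Jl (_ : _ / _ = f l.+1 / f i.+1 * (u l * (u i)^-1)).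
    by apply: (val_idealM valO); [apply: fS | apply: (valringM valO)].
  by field; rewrite fn0 un0 expf_neq0.
have lt_J : (J i < J l)%N.
  by rewrite ltn_neqAle eq_sym Jl (lexicographic_code le_code) // leq_subr.
rewrite (_ : _ / _ = t / f i.+1 * (t ^+ (J l - (J i).+1) * (f l.+1 * (u l * (u i)^-1)))).
  apply: (val_idealM valO); first by rewrite -f0; apply: fS.
  have Ot := val_ideal_valring valO mt; have Ofl := val_ideal_valring valO (mf l.+1).
  by rewrite !(valringM valO) // (valringX valO).
have -> : t ^+ J l = t ^+ J i * (t * t ^+ (J l - (J i).+1)).
  by rewrite -exprS -exprD addnS -addSn subnKC.
by field; rewrite fn0 un0 expf_neq0.
Qed.

(** The extension that kills a uniformizer preserves O, by [leibniz_valring]. *)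
Lemma leibniz_extension_valring (d : k -> k) : leibniz d -> exists D : K -> K,
  [/\ leibniz D, forall a, D (iota a) = iota (d a) & forall x, x \in O -> D x \in O].
Proof.
move=> leibd; have [s [sn0 ms unif]] := exists_uniformizer.
have [D [leibD Diota Ds]] := leibniz_extension chark 0 leibd
  (val_parameter_transcendental valO sn0 ms).
exists D; split=> // x.
exact: (@leibniz_valring _ _ _ chark trdeg1 _ valO _ sn0 ms unif _ _ leibd leibD Diota Ds _).
Qed.

End UniformizerExistence.

(** * Forms and determinants *)

Section MultivariateChainRule.
Variables (k K : comNzRingType) (iota : {rmorphism k -> K}) (n : nat) (Y : 'I_n -> K).
Variables (d : k -> k) (D : K -> K).
Hypotheses (leibD : leibniz D) (Diota : forall a, D (iota a) = iota (d a)).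

Let chain (p : {mpoly k[n]}) :=
  D (mmap iota Y p) = \sum_i mmap iota Y p^`M(i) * D (Y i).

Let chain1 : chain 1.
Proof.
rewrite /chain rmorph1 leibniz1 // big1 // => i _.
by rewrite -mpolyC1 mderivC rmorph0 mul0r.
Qed.

Let chainM p q : chain p -> chain q -> chain (p * q).
Proof.
rewrite /chain => cp cq; rewrite rmorphM leibnizM // cp cq !mulr_sumr -big_split.
apply: eq_bigr => i _; rewrite /= mderivM rmorphD !rmorphM /=; ring.
Qed.

Lemma leibniz_mmap1 m :
  D (mmap1 Y m) = \sum_i mmap iota Y ('X_[m])^`M(i) * D (Y i).
Proof.
rewrite -(mmapX Y iota); suff : chain 'X_[m] by [].
rewrite mpolyXE_id; elim/big_ind: _ => // i _.
elim: (m i) => [|e IH]; first by rewrite expr0.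
rewrite exprS; apply: chainM IH; rewrite /chain (bigD1 i) //= big1 => [|j ji].
  rewrite mmapX mmap1U mderivX mnm1E eqxx scale1r -{1}[U_(i)%MM]add0m addmK.
  by rewrite mpolyX0 rmorph1 mul1r addr0.
by rewrite mderivX mnm1E eq_sym (negPf ji) scale0r rmorph0 mul0r.
Qed.

Lemma leibniz_mmap p : D (mmap iota Y p) =
  mmap (iota \o d) Y p + \sum_i mmap iota Y p^`M(i) * D (Y i).
Proof.
rewrite {1}/mmap leibniz_sum //.
transitivity (\sum_(m <- msupp p) (iota (d p@_m) * mmap1 Y m +
   \sum_i mmap iota Y (p@_m *: ('X_[m])^`M(i)) * D (Y i))).
  apply: eq_bigr => m _; rewrite leibnizM // Diota leibniz_mmap1 addrC; congr (_ + _).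
    by rewrite mulrC.
  by rewrite mulr_sumr; apply: eq_bigr => i _; rewrite mmapZ mulrA.
rewrite big_split exchange_big /=; congr (_ + _); apply: eq_bigr => i _.
rewrite -mulr_suml -rmorph_sum; congr (mmap _ _ _ * _).
by rewrite [in RHS](mpolyE p) linear_sum; apply: eq_bigr => m _; rewrite /= mderivZ.
Qed.

End MultivariateChainRule.

Section HomogeneousForms.
Variables (k : comNzRingType) (n : nat).
Implicit Types (p : {mpoly k[n]}).

Lemma dhomog_mderiv e p i : p \is e.+1.-homog -> p^`M(i) \is e.-homog.
Proof.
move=> /dhomogP hp; apply/dhomogP => m; rewrite mcoeff_msupp mcoeff_deriv => nz.
have E : mdeg (m + U_(i))%MM = e.+1.
  by apply: hp; rewrite mcoeff_msupp; apply: contraNneq nz => ->; rewrite mul0rn.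
by move: E; rewrite mdegD mdeg1 addn1 => -[].
Qed.

Lemma euler_formula e p : p \is e.-homog -> \sum_i 'X_i * p^`M(i) = p *+ e.
Proof.
move=> /dhomogP hp; rewrite [in RHS](mpolyE p) -sumrMnl.
transitivity (\sum_i \sum_(m <- msupp p) p@_m *: ('X_i * ('X_[m])^`M(i))).
  apply: eq_bigr => i _; rewrite {1}(mpolyE p) linear_sum mulr_sumr.
  by apply: eq_bigr => m _; rewrite /= mderivZ scalerAr.
rewrite exchange_big; apply: eq_big_seq => m mp.
have <- : mdeg m = e by apply: hp.
rewrite mdegE.
rewrite -scaler_sumr scalerMnr; congr (_ *: _).
rewrite -sumrMnr; apply: eq_bigr => i _; rewrite mderivX -scalerAr -mpolyXD.
have [mi0|mi] := posnP (m i); first by rewrite mi0 scale0r mulr0n.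
rewrite scaler_nat addmC submK //.
by rewrite lep1mP -lt0n.
Qed.

Lemma mmap1_scale (K : comNzRingType) (c : K) (Y : 'I_n -> K) m :
  mmap1 (fun i => c * Y i) m = c ^+ mdeg m * mmap1 Y m.
Proof.
rewrite /mmap1 mdegE -prodrXr -big_split.
by apply: eq_bigr => i _; rewrite exprMn.
Qed.

Lemma mmap_scale (K : comNzRingType) (iota : k -> K) c (Y : 'I_n -> K) e p :
  p \is e.-homog -> mmap iota (fun i => c * Y i) p = c ^+ e * mmap iota Y p.
Proof.
move=> /dhomogP hp; rewrite /mmap mulr_sumr; apply: eq_big_seq => m mp.
have <- : mdeg m = e by apply: hp.
by rewrite mmap1_scale mulrCA.
Qed.

Lemma mmap1_muln (K : comNzRingType) (Y : 'I_n -> K) i e : mmap1 Y (U_(i) *+ e) = Y i ^+ e.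
Proof.
rewrite -(mmap1U Y i) /mmap1 -prodrXl; apply: eq_bigr => j _.
by rewrite mulmnE exprM.
Qed.

End HomogeneousForms.

(** * Determinants of four vectors in K^4 *)

Section CrossProduct.
Variable K : fieldType.
Implicit Types a b c e phi : 'I_4 -> K.

Let o0 : 'I_4 := @Ordinal 4 0 isT.
Let o1 : 'I_4 := @Ordinal 4 1 isT.
Let o2 : 'I_4 := @Ordinal 4 2 isT.
Let o3 : 'I_4 := @Ordinal 4 3 isT.

Definition minor3 a b c i j l : K :=
  a i * (b j * c l - b l * c j) - a j * (b i * c l - b l * c i) + a l * (b i * c j - b j * c i).

(** The cofactors of the last row, signed so that the product with e is the determinant of the rows
    a, b, c, e. *)
Definition cross a b c (j : 'I_4) : K :=
  match val j with
  | 0 => - minor3 a b c o1 o2 o3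
  | 1 => minor3 a b c o0 o2 o3
  | 2 => - minor3 a b c o0 o1 o3
  | _ => minor3 a b c o0 o1 o2
  end.

Definition dot a b : K := \sum_i a i * b i.

Definition det4 a b c e : K := dot (cross a b c) e.

Let sum4 (f : 'I_4 -> K) : \sum_i f i = f o0 + f o1 + f o2 + f o3.
Proof.
rewrite !big_ord_recl big_ord0 addr0 !addrA.
by congr (f _ + f _ + f _ + f _); apply: val_inj.
Qed.

Let ordP (P : 'I_4 -> Prop) : P o0 -> P o1 -> P o2 -> P o3 -> forall i, P i.
Proof.
move=> P0 P1 P2 P3 [[|[|[|[|i]]]] //= lti].
- by rewrite (_ : Ordinal _ = o0) //; apply: val_inj.
- by rewrite (_ : Ordinal _ = o1) //; apply: val_inj.
- by rewrite (_ : Ordinal _ = o2) //; apply: val_inj.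
- by rewrite (_ : Ordinal _ = o3) //; apply: val_inj.
Qed.

Definition basis_vec (j : 'I_4) : 'I_4 -> K := fun i => (i == j)%:R.

(** The effect of rescaling homogeneous coordinates by x, with y standing for the differential of
    x. *)
Lemma det4_scale14 x y a b c e :
  det4 a (fun i => x * b i) c (fun i => x * e i + y * b i) = x ^+ 2 * det4 a b c e.
Proof. by rewrite /det4 /dot !sum4 /cross /minor3 /=; ring. Qed.

Lemma det4_lin3 x y z a b c e :
  det4 a b (fun i => x * c i + y * b i + z * e i) e = x * det4 a b c e.
Proof. by rewrite /det4 /dot !sum4 /cross /minor3 /=; ring. Qed.

Lemma det4_lin1 x a a' b c e :
  det4 (fun i => x * a i - a' i) b c e = x * det4 a b c e - det4 a' b c e.
Proof. by rewrite /det4 /dot !sum4 /cross /minor3 /=; ring. Qed.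

Lemma det4D3 a b c c' e : det4 a b (fun i => c i + c' i) e = det4 a b c e + det4 a b c' e.
Proof. by rewrite /det4 /dot !sum4 /cross /minor3 /=; ring. Qed.

Lemma det4Z3 x a b c e : det4 a b (fun i => x * c i) e = x * det4 a b c e.
Proof. by rewrite /det4 /dot !sum4 /cross /minor3 /=; ring. Qed.

Lemma det4_13 a b e : det4 a b a e = 0.
Proof. by rewrite /det4 /dot !sum4 /cross /minor3 /=; ring. Qed.

(** Cramer's rule for the linear system with unknown [phi] whose right-hand sides are the four dot
    products. *)
Lemma det4_cramer phi a b c e l : det4 a b c e * phi l =
  dot phi a * det4 (basis_vec l) b c e + dot phi b * det4 a (basis_vec l) c e +
  dot phi c * det4 a b (basis_vec l) e + dot phi e * det4 a b c (basis_vec l).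
Proof.
by move: l; apply: ordP; rewrite /det4 /dot !sum4 /cross /minor3 /basis_vec /=; ring.
Qed.

Lemma det4_orthogonal phi a b c e l : phi l != 0 ->
  dot phi a = 0 -> dot phi b = 0 -> dot phi c = 0 -> dot phi e = 0 -> det4 a b c e = 0.
Proof.
move=> phil a0 b0 c0 e0; apply: (mulIf phil).
by rewrite det4_cramer a0 b0 c0 e0 !mul0r !addr0.
Qed.

(** Up to sign the four determinants are the minors on increasing triples; alternation gives the
    others. *)
Lemma det4_basis_eq0 a b e i j l :
  (forall h, det4 a b (basis_vec h) e = 0) -> minor3 a b e i j l = 0.
Proof.
move=> h.
have h0 : minor3 a b e o1 o2 o3 = 0.
  by rewrite -(h o0) /det4 /dot !sum4 /cross /minor3 /basis_vec /=; ring.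
have h1 : minor3 a b e o0 o2 o3 = 0.
  by rewrite -[LHS]opprK -[RHS]oppr0 -(h o1) /det4 /dot !sum4 /cross /minor3 /basis_vec /=; ring.
have h2 : minor3 a b e o0 o1 o3 = 0.
  by rewrite -(h o2) /det4 /dot !sum4 /cross /minor3 /basis_vec /=; ring.
have h3 : minor3 a b e o0 o1 o2 = 0.
  by rewrite -[LHS]opprK -[RHS]oppr0 -(h o3) /det4 /dot !sum4 /cross /minor3 /basis_vec /=; ring.
have alt12 x y z : minor3 a b e x y z = - minor3 a b e y x z by rewrite /minor3; ring.
have alt23 x y z : minor3 a b e x y z = - minor3 a b e x z y by rewrite /minor3; ring.
have diag x z : minor3 a b e x x z = 0 by rewrite /minor3; ring.
have diag' x z : minor3 a b e z x x = 0 by rewrite /minor3; ring.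
have diag'' x z : minor3 a b e x z x = 0 by rewrite /minor3; ring.
have Z x y z : minor3 a b e x y z = 0 -> [/\ minor3 a b e x z y = 0, minor3 a b e y x z = 0,
   minor3 a b e y z x = 0, minor3 a b e z x y = 0 & minor3 a b e z y x = 0].
  move=> E; split.
  - by rewrite alt23 E oppr0.
  - by rewrite alt12 E oppr0.
  - by rewrite alt23 alt12 E !oppr0.
  - by rewrite alt12 alt23 E !oppr0.
  - by rewrite alt12 alt23 alt12 E !oppr0.
have [? ? ? ? ?] := Z _ _ _ h0; have [? ? ? ? ?] := Z _ _ _ h1.
have [? ? ? ? ?] := Z _ _ _ h2; have [? ? ? ? ?] := Z _ _ _ h3.
by move: i; apply: ordP; move: j; apply: ordP; move: l; apply: ordP.
Qed.

End CrossProduct.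

(** * Regular differentials from deformations of the surface *)

(** A coordinate of least value works: the chart where it is nonzero contains the centre of the
    place O. *)
Lemma val_normalization (k : closedFieldType) (K : fieldType) (iota : {rmorphism k -> K})
    (O : {pred K}) (I : finType) (X : I -> K) i0 : valuation_ring iota O -> X i0 != 0 ->
  exists2 r, X r != 0 & forall i, X i / X r \in O.
Proof.
move=> valO Xi0.
suff [r Xr Or] : exists2 r, X r != 0 & forall i, i \in enum I -> X i / X r \in O.
  by exists r => // i; apply: Or; rewrite mem_enum.
elim: (enum I) => [|a s [r Xr Or]]; first by exists i0.
have [Oar|nOar] := boolP (X a / X r \in O).
  by exists r => // i; rewrite inE => /predU1P[->|/Or].
have Xa : X a != 0 by apply: contraNneq nOar => ->; rewrite mul0r (valring0 valO).
have Ora : X r / X a \in O by rewrite -invf_div (valringV valO).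
exists a => // i; rewrite inE => /predU1P[->|/Or Oir].
  by rewrite divff // (valring1 valO).
rewrite (_ : X i / X a = X i / X r * (X r / X a)); first exact: (valringM valO).
by rewrite mulrA divfK.
Qed.

Section GenusOfCurve.
Variables (k : closedFieldType) (K : fieldType) (iota : {rmorphism k -> K}).
Hypothesis chark : [pchar k] =i pred0.
Hypothesis trdeg1 : has_trdeg iota 1.
Variables (X : 'I_4 -> K) (o : 'I_4).
Hypothesis Xo : X o = 1.
Hypothesis genX : forall x, exists f g : {mpoly k[4]},
  mmap iota X g != 0 /\ x = mmap iota X f / mmap iota X g.
Variables (d : nat) (F : {mpoly k[4]}).
Hypotheses (d5 : (5 <= d)%N) (homF : F \is d.-homog) (FX : mmap iota X F = 0).
Variable del : 'X_{1..4} -> k -> k.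
Hypothesis leib_del : forall m, mdeg m = d -> leibniz (del m).
Hypothesis del_coef : forall m, mdeg m = d -> exists c, forall m',
  mdeg m' = d -> del m F@_m' = (m' == m)%:R - c * F@_m'.

Local Notation ev Y := (mmap iota Y).
Local Notation grad Y := (fun j => mmap iota Y F^`M(j)).

Definition extends_del (D : 'X_{1..4} -> K -> K) : Prop :=
  forall m, mdeg m = d -> leibniz (D m) /\ forall a, D m (iota a) = iota (del m a).

(** On F = 0 the correction c F allowed by [del_coef] disappears and only the monomial m
    survives. *)
Lemma mmap_del Y m : mdeg m = d -> ev Y F = 0 -> mmap (iota \o del m) Y F = mmap1 Y m.
Proof.
move=> md FY; have [c delE] := del_coef md.
(* If m were missing from F, its coefficient 0 would have derivative 1. *)
have mF : m \in msupp F.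
  rewrite mcoeff_msupp; apply/eqP => Fm; have := delE m md.
  rewrite Fm (leibniz0 (leib_del md)) eqxx mulr0 subr0 => /esym/eqP.
  by rewrite oner_eq0.
transitivity (\sum_(m' <- msupp F)
    ((m' == m)%:R * mmap1 Y m' - iota c * (iota F@_m' * mmap1 Y m'))).
  apply: eq_big_seq => m' m'F; rewrite /= delE; last by have /dhomogP hF := homF; apply: hF.
  by rewrite rmorphB rmorphM rmorph_nat mulrBl mulrA.
rewrite sumrB -mulr_sumr -/(mmap iota Y F) FY mulr0 subr0.
rewrite (bigD1_seq m) ?msupp_uniq //= eqxx mul1r big1 ?addr0 // => m' /negPf ->.
by rewrite mul0r.
Qed.

Lemma del_tangent D Y m : extends_del D -> mdeg m = d -> ev Y F = 0 ->
  dot (grad Y) (fun j => D m (Y j)) = - mmap1 Y m.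
Proof.
move=> exD md FY; have [leibD Diota] := exD _ md.
have := leibniz_mmap Y leibD Diota F.
rewrite FY leibniz0 // mmap_del // => /esym/eqP; rewrite addrC addr_eq0 => /eqP <-.
by [].
Qed.

Lemma derivation_tangent delta Y : derivation iota delta -> ev Y F = 0 ->
  dot (grad Y) (fun j => delta (Y j)) = 0.
Proof.
move=> ddelta FY; have leibD := derivation_leibniz ddelta.
have Diota a : delta (iota a) = iota 0 by rewrite (derivation_iota a ddelta) rmorph0.
have := leibniz_mmap Y (d := fun=> 0) leibD Diota F; rewrite FY leibniz0 // => /esym.
rewrite {1}/mmap big1 ?add0r => [|m _]; last by rewrite /= rmorph0 mul0r.
by [].
Qed.

Lemma euler_tangent Y : ev Y F = 0 -> dot (grad Y) Y = 0.
Proof.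
move=> FY; have := congr1 (mmap iota Y) (euler_formula homF).
rewrite rmorphMn /= FY mul0rn => <-; rewrite rmorph_sum.
by apply: eq_bigr => j _; rewrite rmorphM /= mmapX mmap1U mulrC.
Qed.

(* A vector field sum_m q_m d/da_m + sum_j p_j d/dx_j on the universal surface,
   with the sum over the pairs (m, q_m) of qs, twisted by O(d - 4). *)
Definition tangent_field (qs : seq ('X_{1..4} * {mpoly k[4]}))
    (p : 'I_4 -> {mpoly k[4]}) : Prop :=
  [/\ forall x, x \in qs -> mdeg x.1 = d /\ x.2 \is (d - 4).-homog,
      forall j, p j \is (d - 3).-homog &
      \sum_(x <- qs) x.2 * 'X_[x.1] = \sum_j F^`M(j) * p j].

Definition lifted_field (D : 'X_{1..4} -> K -> K) qs (p : 'I_4 -> {mpoly k[4]})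
    Y (j : 'I_4) : K :=
  \sum_(x <- qs) ev Y x.2 * D x.1 (Y j) + ev Y (p j).

(** Each D_m Y contributes - Y^m, and the equation in [tangent_field] cancels these against grad F .
    p. *)
Lemma lifted_field_tangent D qs p Y : extends_del D -> tangent_field qs p -> ev Y F = 0 ->
  dot (grad Y) (lifted_field D qs p Y) = 0.
Proof.
move=> exD [qsP _ E] FY; rewrite /dot /lifted_field.
under eq_bigr do rewrite mulrDr mulr_sumr.
rewrite big_split /= exchange_big /=.
have := congr1 (mmap iota Y) E; rewrite !rmorph_sum /= => E1.
under [X in _ + X]eq_bigr do rewrite -rmorphM /=.
rewrite -E1 -big_split /= big1_seq // => x /andP[_ xqs].
have [md _] := qsP _ xqs; rewrite rmorphM /= mmapX.
transitivity (ev Y x.2 * (dot (grad Y) (fun j => D x.1 (Y j)) + mmap1 Y x.1)).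
  by rewrite mulrDr mulr_sumr; congr (_ + _); apply: eq_bigr => j _; rewrite mulrCA.
by rewrite del_tangent // addNr mulr0.
Qed.

(** The monomial x_r^d is 1 on the chart Y r = 1, so the vector obtained from its derivation has
    product -1 with grad F there. *)
Definition corner (r : 'I_4) : 'X_{1..4} := (U_(r) *+ d)%MM.

Lemma mdeg_corner r : mdeg (corner r) = d.
Proof. by rewrite mdegMn mdeg1 mul1n. Qed.

(* The Poincare residue of the contraction of the volume form with the field: on
   the curve, det(b, Y, u, dY) does not depend on the vector b with
   grad F . b = -1, and the derivation attached to the monomial x_r ^ d provides
   such a b on the whole chart Y r = 1, so that no chart of the surface itself is
   needed. *)
Definition residue_form D qs p Y r : differential K :=
  [seq (cross (fun i => D (corner r) (Y i)) Y (lifted_field D qs p Y) j, Y j) | j <- enum 'I_4].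

Lemma contract_residue_form D qs p Y r delta : contract (residue_form D qs p Y r) delta =
  det4 (fun i => D (corner r) (Y i)) Y (lifted_field D qs p Y) (fun j => delta (Y j)).
Proof. by rewrite /contract big_map big_enum. Qed.

Section Regularity.
Variables (D : 'X_{1..4} -> K -> K).
Variables (qs : seq ('X_{1..4} * {mpoly k[4]})) (p : 'I_4 -> {mpoly k[4]}).
Hypotheses (exD : extends_del D) (fieldqp : tangent_field qs p).

(* Two extensions of the same derivation of k differ by a derivation over k,
   which is proportional to delta, and four vectors orthogonal to grad F are
   linearly dependent. *)
Lemma residue_form_chart D' r lam delta : extends_del D' -> X r != 0 -> lam = (X r)^-1 ->
  derivation iota delta ->
  contract (residue_form D' qs p (fun i => lam * X i) r) delta =
  contract (residue_form D qs p X o) delta.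
Proof.
move=> exD' Xr lamE derd; rewrite !contract_residue_form.
set Y := fun i => lam * X i; set w := fun i => D _ (X i); set w' := fun i => D' _ (Y i).
have lam0 : lam != 0 by rewrite lamE invr_eq0.
have FY : ev Y F = 0 by rewrite (mmap_scale _ _ _ homF) FX mulr0.
have leibd := derivation_leibniz derd.
pose dX j := delta (X j).
have -> : (fun j => delta (Y j)) = (fun j => lam * dX j + delta lam * X j).
  by apply/funext => j; rewrite /Y leibnizM // [_ * delta lam]mulrC.
rewrite -/dX det4_scale14.
have [[l dXl]|noX] := pselect (exists l, dX l != 0); last first.
  have dX0 : dX = fun=> 0.
    by apply/funext => j; apply/eqP; apply: contrapT => /negP dXj; apply: noX; exists j.
  by rewrite dX0 /det4 /dot !big1 ?mulr0 // => j _; rewrite mulr0.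
have [qsP homp _] := fieldqp.
pose eps m j := D' m (X j) - D m (X j).
pose c m := eps m l / dX l.
have epsE m j : mdeg m = d -> D' m (X j) = D m (X j) + c m * dX j.
  move=> md; have [leibDm Dmi] := exD md; have [leibDm' Dmi'] := exD' _ md.
  have dereps : derivation iota (fun x => D' m x - D m x).
    split.
    - by move=> x y; rewrite (leibnizD leibDm) (leibnizD leibDm'); ring.
    - by move=> x y; rewrite (leibnizM leibDm) (leibnizM leibDm'); ring.
    - by move=> a; rewrite Dmi Dmi' subrr.
  have := derivation_proportional chark trdeg1 (X l) (X j) dereps derd.
  rewrite -/(eps m l) -/(eps m j) -/(dX l) -/(dX j) => E.
  by rewrite /c mulrAC E mulfK // /eps addrC subrK.
pose u := lifted_field D qs p X.
(* The change of chart multiplies u by lam^(d - 3), up to multiples of X and dX, which drop out of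
   the determinant. *)
have -> : lifted_field D' qs p Y = (fun j => lam ^+ (d - 3) * u j +
    (\sum_(x <- qs) ev Y x.2 * D' x.1 lam) * X j +
    (lam ^+ (d - 3) * \sum_(x <- qs) ev X x.2 * c x.1) * dX j).
  apply/funext => j; rewrite /lifted_field /u /lifted_field (mmap_scale _ _ _ (homp j)).
  suff -> : \sum_(x <- qs) ev Y x.2 * D' x.1 (Y j) =
      lam ^+ (d - 3) * \sum_(x <- qs) ev X x.2 * D x.1 (X j) +
      (\sum_(x <- qs) ev Y x.2 * D' x.1 lam) * X j +
      (lam ^+ (d - 3) * \sum_(x <- qs) ev X x.2 * c x.1) * dX j by ring.
  rewrite mulr_suml !mulr_sumr mulr_suml -!big_split /=.
  apply: eq_big_seq => x xqs; have [md homx] := qsP _ xqs.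
  have [leibDx' _] := exD' _ md.
  rewrite (leibnizM leibDx') epsE // (mmap_scale _ _ _ homx).
  by rewrite (_ : (d - 3 = (d - 4).+1)%N) ?exprS; [ring | lia].
rewrite det4_lin3.
have dotw : dot (grad X) w = -1.
  by rewrite del_tangent ?mdeg_corner // mmap1_muln Xo expr1n.
(* The entries of grad F have degree d - 1, so lam^(d - 1) w' and w have the same product with grad
   F(X), and their difference is orthogonal to it. *)
have dotw' : lam ^+ d.-1 * dot (grad X) w' = -1.
  have : dot (grad Y) w' = -1.
    by rewrite del_tangent ?mdeg_corner // mmap1_muln /Y lamE mulVf // expr1n.
  move=> <-; rewrite /dot mulr_sumr; apply: eq_bigr => j _.
  rewrite (@mmap_scale _ _ _ _ _ _ d.-1) ?mulrA //.
  by apply: dhomog_mderiv; rewrite prednK //; apply: leq_trans d5.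
have [l' grad_l'] : exists l', mmap iota X F^`M(l') != 0.
  apply: contrapT => no; have := dotw; rewrite /dot big1 => [/eqP|j _].
    by rewrite eq_sym oppr_eq0 oner_eq0.
  have [->|gj] := eqVneq (mmap iota X F^`M(j)) 0; first by rewrite mul0r.
  by case: no; exists j.
have : det4 (fun i => lam ^+ d.-1 * w' i - w i) X u dX = 0.
  apply: (det4_orthogonal (phi := grad X) grad_l').
  - rewrite /dot; under eq_bigr do rewrite mulrBr mulrCA.
    by rewrite sumrB -mulr_sumr -/(dot (grad X) w') -/(dot (grad X) w) dotw dotw' subrr.
  - exact: euler_tangent.
  - exact: lifted_field_tangent.
  - exact: derivation_tangent.
rewrite det4_lin1 => /eqP; rewrite subr_eq0 => /eqP <-.
(* The factor lam^2 from X and dX and the factor lam^(d - 3) from u make up exactly the lam^(d - 1)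
   that normalizes w'; this is the purpose of the twist by O(d - 4). *)
rewrite mulrA -exprD; congr (_ ^+ _ * _); lia.
Qed.

(** At a place O, take a chart r around its centre and extensions D' preserving O: all entries of
    the form then lie in O, and by [residue_form_chart] the differential is the same. *)
Lemma residue_form_regular : regular_differential iota (residue_form D qs p X o).
Proof.
move=> O valO.
have Xon0 : X o != 0 by rewrite Xo oner_neq0.
have [r Xr OXr] := val_normalization valO Xon0.
have /choice[D' D'P] : forall m, exists D' : K -> K, mdeg m = d ->
    [/\ leibniz D', forall a, D' (iota a) = iota (del m a) & forall x, x \in O -> D' x \in O].
  move=> m; have [md|md] := eqVneq (mdeg m) d; last by exists id => /eqP; rewrite (negPf md).
  have [D' D'P] := leibniz_extension_valring chark trdeg1 genX valO (leib_del md).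
  by exists D'.
have exD' : extends_del D' by move=> m /D'P[].
exists (residue_form D' qs p (fun i => (X r)^-1 * X i) r).
  by move=> delta derd; rewrite (residue_form_chart exD' Xr erefl derd).
move=> fg /mapP[j _ ->] /=.
have OY i : (X r)^-1 * X i \in O by rewrite mulrC.
have Oev q : ev (fun i => (X r)^-1 * X i) q \in O.
  apply: (valring_sum valO) => m _; apply: (valringM valO); first exact: (valring_iota valO).
  by apply: (valring_prod valO) => i _; apply: (valringX valO).
have Ow i : D' (corner r) ((X r)^-1 * X i) \in O.
  by have [_ _] := D'P _ (mdeg_corner r); apply.
have Ou i : lifted_field D' qs p (fun i => (X r)^-1 * X i) i \in O.
  apply: (valringD valO) => //; rewrite big_seq; apply: (valring_sum valO) => x xqs.
  have [qsP _ _] := fieldqp; have [md _] := qsP _ xqs.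
  by apply: (valringM valO) => //; have [_ _] := D'P _ md; apply.
split=> //; rewrite /cross /minor3.
have valN x : x \in O -> - x \in O by apply: (valringN valO).
case: (val j) => [|[|[|_]]]; try apply: valN;
  repeat first [exact: Ow | exact: OY | exact: Ou | apply: (valringB valO)
    | apply: (valringD valO) | apply: (valringM valO)].
Qed.

End Regularity.

(** * Nonvanishing of the genus *)

Lemma exists_global_extension : exists D, extends_del D.
Proof.
have [t trt] := exists_transcendental trdeg1.
suff /choice[D DP] : forall m, exists D : K -> K, mdeg m = d ->
  leibniz D /\ forall a, D (iota a) = iota (del m a) by exists D.
move=> m; have [md|md] := eqVneq (mdeg m) d; last by exists id => /eqP; rewrite (negPf md).
by have [D [? ? _]] := leibniz_extension chark 0 (leib_del md) trt; exists D.
Qed.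

(** Extend d/dt for a transcendental t; if it killed every X l it would kill K, which they generate
    over k. *)
Lemma exists_nonzero_derivation : exists delta l,
  derivation iota delta /\ delta (X l) != 0.
Proof.
have [t trt] := exists_transcendental trdeg1.
have [delta [leibd diota dt]] := leibniz_extension chark 1 (leibniz_cst0 k) trt.
have derd : derivation iota delta.
  by apply: leibniz_derivation => // a; rewrite diota rmorph0.
suff [l dl] : exists l, delta (X l) != 0 by exists delta, l.
apply: contrapT => noX; have dX l : delta (X l) = 0.
  by apply/eqP; apply: contrapT => /negP dXl; apply: noX; exists l.
have dev p : delta (ev X p) = 0.
  rewrite (leibniz_mmap X leibd diota) big1 => [|j _]; last by rewrite dX mulr0.
  by rewrite addr0 /mmap big1 // => m _; rewrite /= rmorph0 mul0r.
have [f [g [gn0 tE]]] := genX t.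
have := leibnizM leibd t (ev X g); rewrite {1}tE divfK // !dev dt mulr0 add0r mulr1.
by move=> /esym/eqP; rewrite (negPf gn0).
Qed.

(* The vertical fields x_a d/d(x_b mu) - x_b d/d(x_a mu), twisted by O(1), and
   the infinitesimal action of gl_4 generate T(1) on the universal surface. *)
Section Generators.
Variables (D : 'X_{1..4} -> K -> K) (delta : K -> K).
Hypothesis exD : extends_del D.
Let w i := D (corner o) (X i).
Let L u := det4 w X u (fun i => delta (X i)).
Hypothesis L0 : forall qs p, tangent_field qs p -> L (lifted_field D qs p X) = 0.

Let LD u v : L (fun i => u i + v i) = L u + L v. Proof. exact: det4D3. Qed.
Let LZ a u : L (fun i => a * u i) = a * L u. Proof. exact: det4Z3. Qed.

Let L_sum I (r : seq I) (f : I -> 'I_4 -> K) :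
  L (fun i => \sum_(x <- r) f x i) = \sum_(x <- r) L (f x).
Proof.
elim: r => [|x r IH].
  transitivity (L (fun i => 0 * X i)); last by rewrite LZ mul0r big_nil.
  by congr L; apply/funext => i; rewrite big_nil mul0r.
rewrite big_cons -IH -LD; congr L; apply/funext => i; exact: big_cons.
Qed.

Lemma det_vertical mu j : mdeg mu = d.-1 ->
  L (fun i => D (U_(j) + mu)%MM (X i)) = X j * L (fun i => D (U_(o) + mu)%MM (X i)).
Proof.
move=> mdmu; have dE : d = d.-1.+1 by rewrite prednK //; apply: leq_trans d5.
have md l : mdeg (U_(l) + mu)%MM = d by rewrite mdegD mdeg1 mdmu add1n -dE.
(* The field x_o d/d(x_j mu) - x_j d/d(x_o mu) multiplied by x_o^(d - 5), an exponent that calls for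
   d >= 5. *)
pose qs : seq ('X_{1..4} * {mpoly k[4]}) :=
  [:: ((U_(j) + mu)%MM, 'X_o ^+ (d - 4)); ((U_(o) + mu)%MM, - ('X_j * 'X_o ^+ (d - 5)))].
have homX l : ('X_l : {mpoly k[4]}) \is 1.-homog by rewrite dhomogX; apply/eqP/mdeg1.
have homXn e : ('X_o ^+ e : {mpoly k[4]}) \is e.-homog.
  by have := dhomogMn e (homX o); rewrite mul1n.
have tf : tangent_field qs (fun=> 0).
  split.
  - move=> x; rewrite !inE => /orP[] /eqP -> /=; split=> //.
    by rewrite rpredN (_ : (d - 4 = 1 + (d - 5))%N) ?dhomogM //; lia.
  - by move=> i; apply: rpred0.
  rewrite !big_cons big_nil /= addr0 [RHS]big1 => [|i _]; last by rewrite mulr0.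
  rewrite !mpolyXD (_ : (d - 4 = (d - 5).+1)%N) ?exprS; last by lia.
  by ring.
have := L0 tf; rewrite (_ : lifted_field _ _ _ _ = fun i => D (U_(j) + mu)%MM (X i) +
    (- X j) * D (U_(o) + mu)%MM (X i)).
  by rewrite LD LZ => /eqP; rewrite mulNr subr_eq0 => /eqP.
apply/funext => i; rewrite /lifted_field !big_cons big_nil !addr0 rmorph0 addr0 /=.
by rewrite rmorphN rmorphM !rmorphXn /= !mmapX !mmap1U Xo !expr1n mulr1 mul1r.
Qed.

Lemma det_w : L w = 0.
Proof. exact: det4_13. Qed.

(** By [det_vertical] the other variables of m are traded for x_o one at a time, until x_o^d is
    reached, where the determinant has the row w twice. *)
Lemma det_vertical0 m : mdeg m = d -> L (fun i => D m (X i)) = 0.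
Proof.
have [e] := ubnP (d - m o)%N; elim: e m => // e IH m; rewrite ltnS => le_e md.
have [[j jo mj]|nj] := pselect (exists2 j, j != o & (0 < m j)%N).
  have mE : m = (U_(j) + (m - U_(j)))%MM by rewrite addmC submK // lep1mP -lt0n.
  have mdB : mdeg (m - U_(j)) = d.-1.
    by move: md; rewrite {1}mE mdegD mdeg1 add1n => <-.
  rewrite mE det_vertical // IH ?mulr0 //; last first.
    by rewrite mdegD mdeg1 mdB add1n prednK //; apply: leq_trans d5.
  rewrite mnmDE mnmBE !mnm1E eqxx (negPf jo) subn0.
  have : (m o < d)%N.
    by rewrite -md mdegE (bigD1 o) //= (bigD1 j) ?jo //=; lia.
  by move: le_e; lia.
suff -> : m = corner o by apply: det_w.
have m0 j : j != o -> m j = 0%N.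
  by move=> jo; apply/eqP; rewrite -leqn0 leqNgt; apply/negP => mj; apply: nj; exists j.
apply/mnmP => j; rewrite mulmnE mnm1E eq_sym.
have [->|/m0 ->] := eqVneq j o; last by rewrite mul0n.
by rewrite mul1n -md mdegE (bigD1 o) //= big1 ?addn0 // => i /m0.
Qed.

Lemma det_basis j : L (@basis_vec K j) = 0.
Proof.
have dE : d = d.-1.+1 by rewrite prednK //; apply: leq_trans d5.
(* The field x_o d/dx_j of gl_4 changes F by G, which a combination of the d/da_m compensates; both
   are multiplied by x_o^(d - 4). The vertical part contributes 0 by [det_vertical0]. *)
pose G : {mpoly k[4]} := 'X_o * F^`M(j).
have homX l : ('X_l : {mpoly k[4]}) \is 1.-homog by rewrite dhomogX; apply/eqP/mdeg1.
have homXn e : ('X_o ^+ e : {mpoly k[4]}) \is e.-homog.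
  by have := dhomogMn e (homX o); rewrite mul1n.
have homG : G \is d.-homog.
  rewrite dE (_ : d.-1.+1 = (1 + d.-1)%N) //; apply: dhomogM => //; apply: dhomog_mderiv.
  by rewrite -dE.
pose qs := [seq (m, G@_m *: 'X_o ^+ (d - 4)) | m <- msupp G].
pose p (i : 'I_4) : {mpoly k[4]} := (i == j)%:R *: 'X_o ^+ (d - 3).
have tf : tangent_field qs p.
  split.
  - move=> _ /mapP[m mG ->] /=; split; last exact: dhomogZ.
    by have /dhomogP := homG; apply.
  - by move=> i; apply: dhomogZ.
  rewrite big_map (bigD1 j) //= [X in _ = _ + X]big1 => [|i ij].
    2: by rewrite /p (negbTE ij) scale0r mulr0.
  rewrite /p eqxx scale1r addr0.
  transitivity ('X_o ^+ (d - 4) * G).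
    rewrite [in RHS](mpolyE G) mulr_sumr; apply: eq_bigr => m _.
    by rewrite /= -scalerAl scalerAr.
  rewrite /G (_ : (d - 3 = (d - 4).+1)%N) ?exprS; [ring | lia].
have := L0 tf.
rewrite (_ : lifted_field _ _ _ _ = fun i =>
    (\sum_(m <- msupp G) iota G@_m * D m (X i)) + basis_vec K j i).
  rewrite LD L_sum big1_seq ?add0r // => m /andP[_ mG].
  by rewrite LZ det_vertical0 ?mulr0 //; have /dhomogP := homG; apply.
apply/funext => i; rewrite /lifted_field big_map; congr (_ + _).
  apply: eq_bigr => m _ /=; rewrite mmapZ rmorphXn /= mmapX mmap1U Xo expr1n mulr1 //.
by rewrite /p mmapZ rmorphXn /= mmapX mmap1U Xo expr1n mulr1 rmorph_nat.
Qed.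

Lemma no_derivation l : derivation iota delta -> delta (X l) = 0.
Proof.
move=> derd; apply/eqP; apply: contraT => dl.
have leibd := derivation_leibniz derd.
have wo : w o = 0.
  by have [leibDo _] := exD (mdeg_corner o); rewrite /w Xo leibniz1.
have dXo : delta (X o) = 0 by rewrite Xo leibniz1.
(* The minors on o, l, i, where X o = 1 and both w o and delta (X o) are 0, make w proportional to
   delta X; then grad F . w would be both 0 and -1. *)
have wE i : w i = w l / delta (X l) * delta (X i).
  have := det4_basis_eq0 o l i det_basis.
  rewrite /minor3 /= wo dXo Xo !(mul0r, mulr0, mul1r, subr0, sub0r).
  by rewrite addrC => /eqP; rewrite subr_eq0 => /eqP E; rewrite mulrAC -E mulfK.
have := del_tangent exD (mdeg_corner o) FX; rewrite mmap1_muln Xo expr1n.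
rewrite (_ : dot _ _ = w l / delta (X l) * dot (grad X) (fun i => delta (X i))).
  by rewrite derivation_tangent // mulr0 => /esym/eqP; rewrite oppr_eq0 oner_eq0.
by rewrite /dot mulr_sumr; apply: eq_bigr => i _; rewrite -/(w i) wE mulrCA.
Qed.

End Generators.

Lemma genus_neq0 : ~ has_genus iota 0.
Proof.
move=> [b [_ reg0]].
have [D exD] := exists_global_extension.
have [delta [l [derd dl]]] := exists_nonzero_derivation.
have : delta (X l) = 0; last by move/eqP; rewrite (negPf dl).
apply: (no_derivation exD) => // qs p tf.
rewrite -contract_residue_form.
(* A basis indexed by ['I_0] leaves only the empty combination, so every regular differential
   contracts to 0. *)
have [c [same _]] := reg0 _ (residue_form_regular exD tf).
rewrite same // /lin_comb (_ : enum 'I_0 = [::]) ?/contract ?big_nil //.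
by apply: size0nil; rewrite size_enum_ord.
Qed.

End GenusOfCurve.

(** * Forms with generic coefficients *)

Section Nonvanishing.
Variables (k : closedFieldType) (n : nat).
Hypothesis chark : [pchar k] =i pred0.

(** On a line parallel to an axis, p is a polynomial in one variable without nonroots, hence 0. So
    the partial derivatives vanish everywhere and are 0 by induction on the degree; in
    characteristic 0, p is then constant. *)
Lemma meval_eq0 (p : {mpoly k[n]}) : (forall a, p.@[a] = 0) -> p = 0.
Proof.
have [e] : exists e, forall m, m \in msupp p -> (mdeg m < e)%N.
  by exists (msize p) => m; apply: msize_mdeg_lt.
elim: e p => [|e IH] p supp_p p0.
  apply/mpolyP => m; rewrite mcoeff0; apply/eqP; rewrite mcoeff_eq0.
  by apply/negP => /supp_p.
have dp0 i : p^`M(i) = 0.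
  apply: IH => [m|a].
    rewrite mcoeff_msupp mcoeff_deriv => nz.
    have : (m + U_(i))%MM \in msupp p.
      by rewrite mcoeff_msupp; apply: contraNneq nz => ->; rewrite mul0rn.
    by move=> /supp_p; rewrite mdegD mdeg1 addn1.
  pose v j : {poly k} := (a j)%:P + (i == j)%:R *: 'X.
  have evq q t : (mmap (@polyC k) v q).[t] = q.@[fun j => a j + (i == j)%:R * t].
    rewrite -horner_evalE rmorph_mmap /meval; apply: eq_mmap => [c|j] /=.
      by rewrite horner_evalE hornerC.
    by rewrite horner_evalE hornerD hornerC hornerZ hornerX.
  have q0 : mmap (@polyC k) v p = 0.
    apply/eqP; apply: contraT => /closed_nonrootP[t].
    by rewrite /root evq p0 eqxx.
  have leibd : leibniz (@deriv k).
    by split=> [x y|x y]; rewrite ?derivD // derivM addrC [_ * y]mulrC.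
  have := leibniz_mmap v (d := fun=> 0) leibd (fun c => derivC c) p.
  rewrite q0 deriv0 {1}/mmap big1 ?add0r => [|m _]; last by rewrite /= mul0r.
  rewrite (bigD1 i) //= big1 ?addr0 => [/esym|j]; last first.
    by rewrite eq_sym => /negPf ij; rewrite /v ij scale0r addr0 derivC mulr0.
  rewrite {2}/v eqxx scale1r derivD derivC derivX add0r mulr1 => /(congr1 (horner^~ 0)).
  rewrite /= horner0 evq => <-.
  by apply: meval_eq => j; rewrite mulr0 addr0.
have pm m : m != 0%MM -> p@_m = 0.
  rewrite -mdeg_eq0 mdegE => mn0.
  have [i mi] : exists i, m i != 0%N.
    apply: contrapT => no; move: mn0; rewrite big1 // => i _.
    by apply/eqP; apply: contrapT => /negP mi; apply: no; exists i.
  have := congr1 (mcoeff (m - U_(i))%MM) (dp0 i).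
  rewrite mcoeff_deriv mcoeff0 submK ?lep1mP // -mulr_natr => /eqP.
  by rewrite mulf_eq0 ((pcharf0P k).1 chark) orbF => /eqP.
have pC : p = (p@_0)%:MP.
  apply/mpolyP => m; rewrite mcoeffC; have [->|/pm] := eqVneq m 0%MM; first by rewrite mulr1.
  by rewrite mulr0.
by have := p0 (fun=> 0); rewrite pC mevalC => ->; rewrite mpolyC0.
Qed.

End Nonvanishing.

Section IntegralForms.
Variables (k : closedFieldType) (N : nat).
Hypothesis chark : [pchar k] =i pred0.

Lemma meval_map_intr (p : {mpoly int[N]}) (a : 'I_N -> k) :
  (map_mpoly intr p).@[a] = mmap intr a p.
Proof.
rewrite /map_mpoly rmorph_mmap; apply: eq_mmap => [c|i] /=; first by rewrite mevalC.
by rewrite mevalXU.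
Qed.

Lemma intr_eq0_pchar0 (c : int) : (c%:~R == 0 :> k) = (c == 0).
Proof.
by case: c => n; rewrite ?NegzE ?rmorphN ?oppr_eq0 /= -pmulrn ((pcharf0P k).1 chark).
Qed.

Lemma map_intr_eq0 (p : {mpoly int[N]}) : (map_mpoly (intr : int -> k) p == 0) = (p == 0).
Proof.
apply/eqP/eqP => [p0|->]; last by rewrite rmorph0.
apply/mpolyP => m; apply/eqP; rewrite mcoeff0 -intr_eq0_pchar0.
by rewrite -(mcoeff_map_mpoly intr) p0 mcoeff0.
Qed.

Lemma map_intr_homog (p : {mpoly int[N]}) e : p \is e.-homog ->
  map_mpoly (intr : int -> k) p \is e.-homog.
Proof.
move=> /dhomogP hp; apply/dhomogP => m; rewrite mcoeff_msupp mcoeff_map_mpoly => nz.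
by apply: hp; rewrite mcoeff_msupp; apply: contraNneq nz => ->.
Qed.

(** An enumeration of the integer polynomials through codes of lists of terms; it makes the union of
    hypersurfaces to be removed countable. *)
Definition nth_integral_poly (j : nat) : {mpoly int[N]} :=
  if unpickle j is Some s then \sum_(cm <- (s : seq (int * 'X_{1..N}))) cm.1 *: 'X_[cm.2] else 0.

Lemma nth_integral_poly_surj p : exists j, nth_integral_poly j = p.
Proof.
exists (pickle [seq (p@_m, m) | m <- msupp p]).
by rewrite /nth_integral_poly pickleK big_map [RHS]mpolyE.
Qed.

Definition generic_point (a : 'I_N -> k) : Prop :=
  forall (p : {mpoly int[N]}) e, p \is e.-homog -> p != 0 -> mmap intr a p != 0.

Variables (a : 'I_N -> k) (o : 'I_N).
Hypothesis gena : generic_point a.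

Lemma generic_neq0 i : a i != 0.
Proof.
have := gena (p := 'X_i) (e := 1); rewrite mmapX mmap1U; apply.
  by rewrite dhomogX; apply/eqP/mdeg1.
by rewrite -msupp_eq0 msuppX.
Qed.

Let b i := a i / a o.

Let bo : b o = 1. Proof. by rewrite /b divff // generic_neq0. Qed.

(* The homogenization h of p with respect to 'X_o vanishes at a, so h = 0. *)
Lemma generic_mderiv (p : {mpoly int[N]}) i : i != o -> mmap intr b p = 0 ->
  mmap intr b p^`M(i) = 0.
Proof.
move=> io pb.
pose h : {mpoly int[N]} := \sum_(m <- msupp p) p@_m *: ('X_[m] * 'X_o ^+ (msize p - mdeg m)).
have homXo e : ('X_o ^+ e : {mpoly int[N]}) \is e.-homog.
  have : ('X_o : {mpoly int[N]}) \is 1.-homog by rewrite dhomogX; apply/eqP/mdeg1.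
  by move=> /(dhomogMn e); rewrite mul1n.
have homh : h \is (msize p).-homog.
  rewrite /h big_seq; apply: rpred_sum => m mp; apply: dhomogZ.
  have mdm : (mdeg m <= msize p)%N by apply/ltnW/msize_mdeg_lt.
  rewrite -{2}(subnKC mdm); apply: dhomogM => //; rewrite dhomogX; exact: eqxx.
have evh : mmap intr b h = mmap intr b p.
  rewrite /h rmorph_sum [RHS]/mmap; apply: eq_bigr => m _.
  by rewrite /= mmapZ rmorphM rmorphXn /= !mmapX mmap1U bo expr1n mulr1.
have h0 : h = 0.
  apply/eqP; apply: contraT => hn0.
  have := gena homh hn0.
  have -> : a = (fun j => a o * b j).
    by apply/funext => j; rewrite /b mulrC divfK // generic_neq0.
  by rewrite (mmap_scale _ _ _ homh) evh pb mulr0 eqxx.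
have E0 : mmap intr b h^`M(i) = 0 by rewrite h0 mderiv0 rmorph0.
rewrite -[RHS]E0 [in LHS](mpolyE p) /h !linear_sum !rmorph_sum; apply: eq_bigr => m _.
rewrite /= !mderivZ !mmapZ mderivM; congr (_ * _).
rewrite rmorphD !rmorphM rmorphXn /= [mmap intr b 'X_o]mmapX mmap1U bo expr1n mulr1.
suff -> : ('X_o ^+ (msize p - mdeg m) : {mpoly int[N]})^`M(i) = 0 by rewrite rmorph0 mulr0 addr0.
elim: (_ - _)%N => [|e IH]; first by rewrite expr0 -mpolyC1 mderivC.
by rewrite exprS mderivM IH mulr0 mderivX mnm1E eq_sym (negPf io) scale0r mul0r addr0.
Qed.

(** This is d/db_i on Z[b], well defined by [generic_mderiv] and extended to k. *)
Lemma generic_partial_derivation i : i != o ->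
  exists2 D : k -> k, leibniz D & forall j, D (b j) = (j == i)%:R.
Proof.
move=> io; pose G x c := exists p, x = mmap intr b p /\ c = mmap intr b p^`M(i).
have [|D leibD DG] := derivation_extension chark (G := G).
  split.
  - by move=> c [p [/esym/(generic_mderiv io) -> ->]].
  - by exists 1; rewrite rmorph1 -mpolyC1 mderivC rmorph0.
  - move=> _ _ _ _ [p [-> ->]] [q [-> ->]]; exists (p - q).
    by rewrite mderivB !rmorphB.
  - move=> _ _ _ _ [p [-> ->]] [q [-> ->]]; exists (p * q).
    rewrite mderivM rmorphD !rmorphM /=; split=> //; ring.
exists D => // j; apply: DG; exists 'X_j.
rewrite mmapX mmap1U mderivX mnm1E mmapZ mmapX; split=> //.
have [->|ji] := eqVneq j i; last by rewrite rmorph0 mul0r.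
rewrite rmorph1 mul1r (_ : (U_(i) - U_(i))%MM = 0%MM) ?mmap11 //.
by rewrite -{1}[U_(i)%MM]add0m addmK.
Qed.

Lemma generic_derivation i : exists (D : k -> k) c,
  leibniz D /\ forall j, D (b j) = (j == i)%:R - c * b j.
Proof.
have [->|io] := eqVneq i o; last first.
  have [D leibD Db] := generic_partial_derivation io.
  by exists D, 0; split=> // j; rewrite Db mul0r subr0.
have /choice[D DP] : forall l, exists D : k -> k, l != o ->
    leibniz D /\ forall j, D (b j) = (j == l)%:R.
  move=> l; have [->|lo] := eqVneq l o; first by exists id.
  by have [D] := generic_partial_derivation lo; exists D.
(* For i = o the coordinate b o = 1 is constant; minus the Euler field in the other b l works, with
   c = 1. *)
exists (fun x => - \sum_(l | l != o) b l * D l x), 1; split.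
  split=> [x y|x y].
    rewrite -opprD -big_split; congr (- _); apply: eq_bigr => l /DP[leibD _] /=.
    by rewrite (leibnizD leibD) mulrDr.
  rewrite !mulrN -opprD !mulr_sumr -big_split; congr (- _); apply: eq_bigr => l /DP[leibD _] /=.
  by rewrite (leibnizM leibD); ring.
move=> j; rewrite mul1r.
have [->|jo] := eqVneq j o.
  rewrite [in RHS]bo subrr big1 ?oppr0 // => l lo; have [_ ->] := DP _ lo.
  by rewrite eq_sym (negPf lo) mulr0.
rewrite sub0r (bigD1 j) //= big1 ?addr0 => [|l /andP[lo lj]].
  by have [_ ->] := DP _ jo; rewrite eqxx mulr1.
by have [_ ->] := DP _ lo; rewrite eq_sym (negPf lj) mulr0.
Qed.

End IntegralForms.

(** * Coordinates on a curve *)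

Lemma divf_cancel (F : fieldType) (a b c : F) : c != 0 -> (a / c) / (b / c) = a / b.
Proof. by move=> cn0; rewrite invf_div mulrA divfK. Qed.

Section Coordinates.
Variables (k : closedFieldType) (n : nat) (P : prime_idealr {mpoly k[n]}).

Local Notation K := (function_field P).
Local Notation iota := (Defs.constant P).
Local Notation cls := (fun f => tofrac (coord_class P f)).

Lemma dhomog_gt0_ideal e (p : {mpoly k[n]}) : (forall i, 'X_i \in P) ->
  p \is e.+1.-homog -> p \in P.
Proof.
move=> XP /dhomogP hp; rewrite (mpolyE p) big_seq; apply: rpred_sum => m mp.
have mdm : mdeg m = e.+1 by apply: hp.
have [i mi] : exists i, m i != 0%N.
  apply: contrapT => no; have : mdeg m != 0%N by rewrite mdm.
  rewrite mdegE big1 // => i _.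
  by apply/eqP; apply: contrapT => /negP mi; apply: no; exists i.
rewrite -mul_mpolyC -(submK (m := U_(i)%MM) (m' := m)) ?lep1mP // mpolyXD mulrA.
exact: idealMr.
Qed.

(** If P contained all the variables, every form outside P would have degree 0, and the function
    field would consist of constants. *)
Lemma exists_coordinate : has_trdeg (K := function_field P) iota 1 ->
  exists o, ('X_o : {mpoly k[n]}) \notin P.
Proof.
move=> trdeg1; apply: contrapT => noo.
have XP i : ('X_i : {mpoly k[n]}) \in P.
  by apply: contrapT => /negP Xi; apply: noo; exists i.
have [t trt] := exists_transcendental trdeg1.
have /asboolP[e [f [g [homf homg gP tE]]]] := valP t.
case: e homf homg => [|e] homf homg; last by rewrite (dhomog_gt0_ideal XP homg) in gP.
have cst (q : {mpoly k[n]}) : q \is 0.-homog -> q = (q@_0)%:MP.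
  move=> /dhomogP hq; apply/mpolyP => m; rewrite mcoeffC.
  have [->|mn0] := eqVneq m 0%MM; first by rewrite mulr1.
  rewrite mulr0; apply/eqP; rewrite mcoeff_eq0; apply/negP => /hq /= m0.
  by move: mn0; rewrite -mdeg_eq0 -[mdeg m]/(mdeg m) m0 eqxx.
have tc : t = iota (f@_0 / g@_0).
  apply: val_inj; rewrite fmorph_div /= tE /homog_frac (cst f homf) (cst g homg).
  by rewrite !mcoeffC eqxx !mulr1.
have : hev iota t ('X - (f@_0 / g@_0)%:P) = 0.
  by rewrite rmorphB /= hevX hevC tc subrr.
by move=> /trt/eqP; rewrite polyXsubC_eq0.
Qed.

Variable o : 'I_n.
Hypothesis oP : ('X_o : {mpoly k[n]}) \notin P.

Lemma coordinate_subproof i : homog_frac P 'X_i 'X_o \in @rational_function k n P.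
Proof.
apply/asboolP; exists 1%N, 'X_i, 'X_o; split=> //; rewrite dhomogX; exact/eqP/mdeg1.
Qed.

Definition coordinate i : K := @SubField _ (@rational_function k n P) _ (coordinate_subproof i).

Let clsXo : cls 'X_o != 0.
Proof. by rewrite tofrac_eq0 coord_class_eq0. Qed.

Lemma coordinate_o : coordinate o = 1.
Proof. by apply: val_inj; rewrite /= /homog_frac divff. Qed.

Lemma mmap_coordinate e (f : {mpoly k[n]}) : f \is e.-homog ->
  val (mmap iota coordinate f) = cls f / cls 'X_o ^+ e.
Proof.
move=> homf.
pose v : {rmorphism K -> {fraction coord_ring P}} := [the {rmorphism _ -> _} of val].
pose tau : {rmorphism {mpoly k[n]} -> {fraction coord_ring P}} :=
  [the {rmorphism _ -> _} of @tofrac _ \o coord_class P].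
rewrite -[LHS]/(v _) rmorph_mmap.
transitivity (mmap (tau \o @mpolyC n k) (fun i => (cls 'X_o)^-1 * (tau \o (fun i => 'X_i)) i) f).
  by apply: eq_mmap => // i; rewrite mulrC.
rewrite (mmap_scale _ _ _ homf) -rmorph_mmap mmap_id exprVn mulrC //.
Qed.

Lemma coordinate_generate x : exists f g : {mpoly k[n]},
  mmap iota coordinate g != 0 /\ x = mmap iota coordinate f / mmap iota coordinate g.
Proof.
have /asboolP[e [f [g [homf homg gP xE]]]] := valP x.
have clsg : cls g != 0 by rewrite tofrac_eq0 coord_class_eq0.
have gn0 : mmap iota coordinate g != 0.
  apply/eqP => /(congr1 val); rewrite (mmap_coordinate homg) => /eqP.
  by rewrite mulf_eq0 (negPf clsg) invr_eq0 expf_eq0 (negPf clsXo) andbF.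
exists f, g; split=> //; apply: val_inj.
have E1 := mmap_coordinate homf; have E2 := mmap_coordinate homg.
have E := divf_cancel (cls f) (cls g) (expf_neq0 e clsXo).
transitivity (val (mmap iota coordinate f) / val (mmap iota coordinate g)).
  by rewrite E1 E2 [RHS]E; exact: xE.
by rewrite fmorph_div.
Qed.

Lemma mmap_coordinate_ideal e (f : {mpoly k[n]}) : f \is e.-homog -> f \in P ->
  mmap iota coordinate f = 0.
Proof.
move=> homf fP; apply: val_inj; rewrite (mmap_coordinate homf).
have -> : coord_class P f = 0 by apply/eqP; rewrite coord_class_eq0.
by rewrite rmorph0 mul0r.
Qed.

End Coordinates.

(** * Very general forms *)

Section LinearSystemOfForms.
Variables (k : closedFieldType) (n d : nat).
Hypothesis chark : [pchar k] =i pred0.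

Local Notation N := #|monomials n d|.
Local Notation mon j := (bmnm (enum_val (j : 'I_N))).

Lemma mdeg_monomial (j : 'I_N) : mdeg (mon j) = d.
Proof. by have := enum_valP j; rewrite inE => /eqP. Qed.

Lemma monomial_index (m : 'X_{1..n}) : mdeg m = d -> exists j : 'I_N, mon j = m.
Proof.
move=> md; have lt_md : (mdeg m < d.+1)%N by rewrite md.
have mM : BMultinom lt_md \in monomials n d by rewrite inE /= md.
by exists (enum_rank_in mM (BMultinom lt_md)); rewrite enum_rankK_in.
Qed.

Lemma monomial_inj (i j : 'I_N) : mon i = mon j -> i = j.
Proof. by move=> E; apply/enum_val_inj/val_inj. Qed.

Definition form_of_coefs (a : 'I_N -> k) : {mpoly k[n]} := \sum_j a j *: 'X_[mon j].

Lemma coefs_form_of_coefs a : coefs (form_of_coefs a) = a.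
Proof.
apply/funext => i; rewrite /coefs /form_of_coefs raddf_sum (bigD1 i) //= big1 => [|j ji].
  by rewrite addr0 mcoeffZ mcoeffX eqxx mulr1.
rewrite mcoeffZ mcoeffX (_ : (_ == _) = false) ?mulr0 //.
by apply: contraNF ji => /eqP/monomial_inj ->.
Qed.

Lemma linear_system_form_of_coefs a i : a i != 0 -> linear_system d (form_of_coefs a).
Proof.
move=> ai; split.
  by apply: rpred_sum => j _; apply: dhomogZ; rewrite dhomogX; apply/eqP/mdeg_monomial.
apply: contraNneq ai => F0; rewrite -(coefs_form_of_coefs a) F0 /coefs mcoeff0 //.
Qed.

Definition form_hypersurface (phi : {mpoly k[N]}) (F : {mpoly k[n]}) : Prop :=
  phi.@[@coefs k n d F] = 0.

Lemma zariski_closed_hypersurface phi e : phi \is e.-homog ->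
  @zariski_closed k n d (form_hypersurface phi).
Proof.
move=> homphi; exists (eq phi); split=> [_ <-|F _]; first by exists e.
by split=> [Z _ <- //|]; apply.
Qed.

Lemma proper_hypersurface phi (i : 'I_N) : phi != 0 ->
  @proper_subset k n d (form_hypersurface phi).
Proof.
(* The factor ['X_i] keeps a away from the origin, so that its form is nonzero. *)
move=> phin0; have [a] : exists a, (phi * 'X_i).@[a] != 0.
  apply: contrapT => no; have /eqP : phi * 'X_i = 0.
    apply: (meval_eq0 chark) => a; apply/eqP; apply: contrapT => /negP an0.
    by apply: no; exists a.
  by rewrite mulf_eq0 (negPf phin0) -msupp_eq0 msuppX.
rewrite mevalM mevalXU mulf_eq0 negb_or => /andP[phia ai].
exists (form_of_coefs a); first exact: linear_system_form_of_coefs ai.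
by rewrite /form_hypersurface coefs_form_of_coefs; apply/eqP.
Qed.

(** The closed sets to remove are the zero loci of the countably many nonzero integer forms in the
    coefficients. *)
Lemma very_general_generic (Q : {mpoly k[n]} -> Prop) (i : 'I_N) :
  (forall F, linear_system d F -> generic_point (@coefs k n d F) -> Q F) ->
  @very_general k n d Q.
Proof.
move=> genQ.
pose hom (p : {mpoly int[N]}) := `[< exists e, p \is e.-homog >].
(* The default 1 has an empty zero locus, which is closed and proper and removes nothing. *)
pose phi j : {mpoly k[N]} := let p := nth_integral_poly N j in
  if (p != 0) && hom p then map_mpoly intr p else 1.
exists (fun j => form_hypersurface (phi j)); split=> [j|F lsF notZ].
  split.
    rewrite /phi; case: ifP => [/andP[_ /asboolP[e homp]]|_].
      exact/zariski_closed_hypersurface/map_intr_homog/homp.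
    exact/zariski_closed_hypersurface/dhomog1.
  apply: (proper_hypersurface i); rewrite /phi; case: ifP => [/andP[pn0 _]|_].
    by rewrite map_intr_eq0.
  exact: oner_neq0.
apply: genQ => // p e homp pn0.
have [j jp] := nth_integral_poly_surj p.
have := notZ j; rewrite /form_hypersurface /phi jp pn0.
have -> : hom p by apply/asboolP; exists e.
by rewrite /= meval_map_intr => /eqP.
Qed.

End LinearSystemOfForms.

Lemma complex_pchar0 (R : realType) : [pchar R[i]] =i pred0.
Proof. exact: Num.Theory.pchar_num. Qed.

Section GenericForm.
Variables (k : closedFieldType) (d : nat).
Hypothesis chark : [pchar k] =i pred0.

Lemma generic_no_genus0 (F : {mpoly k[4]}) : (5 <= d)%N -> linear_system d F ->
  generic_point (@coefs k 4 d F) ->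
  forall P : prime_idealr {mpoly k[4]}, lies_on P F -> ~ rational_curve P.
Proof.
move=> d5 [homF Fn0] genF P FP [[_ trdeg1] genus0].
have [o oP] := exists_coordinate trdeg1.
pose N := #|monomials 4 d|.
have [j0 _] : exists j : 'I_N, bmnm (enum_val j) = (U_(o) *+ d)%MM.
  by apply: monomial_index; rewrite mdegMn mdeg1 mul1n.
pose c := @coefs k 4 d F j0.
have cn0 : c != 0 := generic_neq0 genF j0.
(* Scaling one coefficient to 1 keeps the surface and turns the coefficients into the ratios handled
   by [generic_derivation]. *)
pose F' := c^-1 *: F.
have homF' : F' \is d.-homog by apply: dhomogZ.
have F'P : F' \in P by rewrite /F' -mul_mpolyC; apply: idealMr.
have F'coef (j : 'I_N) : F'@_(bmnm (enum_val j)) = @coefs k 4 d F j / c.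
  by rewrite mcoeffZ mulrC.
have /choice[del delP] : forall m : 'X_{1..4}, exists D : k -> k, mdeg m = d ->
    leibniz D /\ exists c', forall m', mdeg m' = d -> D F'@_m' = (m' == m)%:R - c' * F'@_m'.
  move=> m; have [md|md] := eqVneq (mdeg m) d; last by exists id => /eqP; rewrite (negPf md).
  have [i iE] := monomial_index md.
  have [D [c' [leibD DE]]] := generic_derivation chark j0 genF i.
  exists D => _; split=> //; exists c' => m' m'd.
  have [j jE] := monomial_index m'd.
  rewrite -{1 3}jE F'coef DE -jE -iE; congr ((nat_of_bool _)%:R - _).
  by apply/eqP/eqP => [->|/monomial_inj].
apply: (genus_neq0 chark trdeg1 (coordinate_o oP) (coordinate_generate oP) d5 homF'
  (mmap_coordinate_ideal oP homF' F'P) (del := del)) => //.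
- by move=> m /delP[].
- by move=> m /delP[].
Qed.

End GenericForm.

Local Close Scope ring_scope.

Theorem corollary2p2 (R : realType) (d : nat) (hd : 5 <= d) :
  @very_general R[i] 4 d (fun F : {mpoly R[i][4]} =>
    ~ exists P : prime_idealr {mpoly R[i][4]}, rational_curve P /\ lies_on P F).
Proof.
have [i0 _] : exists j : 'I_#|monomials 4 d|, bmnm (enum_val j) = (U_(ord0) *+ d)%MM.
  by apply: monomial_index; rewrite mdegMn mdeg1 mul1n.
apply: (very_general_generic (complex_pchar0 R) i0) => F lsF genF [P [ratP PF]].
exact: (generic_no_genus0 (complex_pchar0 R) hd lsF genF PF ratP).
Qed.
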